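(* Let $\Omega\subset\mathbb R^m$ be the projected spectrahedron $$\Omega=\Big\{v\in\mathbb R^m:\ \exists\,\xi\in\mathbb R^N,\ F_0+\sum_{i=1}^mv_iF_i+\sum_{t=1}^N\xi_tM_t\succeq0\Big\},\qquad F_i,M_t\in\mathbb S^\nu,$$ let $g_\ell^k$ ($\ell=1,\ldots,L$, $k=1,\ldots,r$) and $h_j$ ($j=1,\ldots,J$) be SOS-convex polynomials on $\mathbb R^m$, and let $\gamma_1,\ldots,\gamma_J\in\mathbb R$. Assume: (a) $\Omega$ is compact and there exist $\bar v\in\mathbb R^m$, $\bar\xi\in\mathbb R^N$ with $F_0+\sum_{i=1}^m\bar v_iF_i+\sum_{t=1}^N\bar\xi_tM_t\succ0$; (b) $(\gamma_1,\ldots,\gamma_J,1)\in\operatorname{int}\Big\{\big\{\big(\int_\Omega h_1\,d\mu,\ldots,\int_\Omega h_J\,d\mu,\int_\Omega1\,d\mu\big):\mu\in X,\ \mu\succeq_{\mathcal B}0\big\}+\mathbb R_+^J\times\{0\}\Big\}$ (interior in $\mathbb R^{J+1}$); (c) the moment problem $$\text{(P)}\qquad\min_{\mu\in X}\Big\{\int_\Omega\min_{k=1,\ldots,r}\max_{\ell=1,\ldots,L}g_\ell^k\,d\mu\ :\ \int_\Omega h_j\,d\mu\le\gamma_j,\ j=1,\ldots,J,\ \int_\Omega1\,d\mu=1,\ \mu\succeq_{\mathcal B}0\Big\}$$ admits a minimizer. Then $\min\text{(P)}=\max\text{(D)}$, where (D) is the problem of maximizing $$-\sum_{j=1}^J\lambda_j\gamma_j-\lambda_{J+1}$$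 over $\lambda\in\mathbb R_+^J\times\mathbb R$, $Z_k\in\mathbb S_+^\nu$ and $\delta^k=(\delta^k_1,\ldots,\delta^k_L)\in\Delta$ ($k=1,\ldots,r$), subject to, for all $k=1,\ldots,r$, $$\sum_{\ell=1}^L\delta_\ell^kg_\ell^k(v)+\sum_{j=1}^J\lambda_jh_j(v)+\lambda_{J+1}-\operatorname{tr}(Z_kF_0)-\sum_{i=1}^mv_i\operatorname{tr}(Z_kF_i)\in\Sigma_d^2(v),$$ $$\operatorname{tr}(Z_kM_t)=0,\quad t=1,\ldots,N,$$ with $d$ the smallest even integer satisfying $d\ge\max\{\max_{k,\ell}\deg g_\ell^k,\ \max_j\deg h_j\}$.
   Context: $X$ is the vector space of finite signed regular Borel measures on $(\Omega,\mathcal B)$, where $\mathcal B$ is the Borel $\sigma$-algebra of $\Omega$; $\mu\succeq_{\mathcal B}0$ means $\mu(A)\ge0$ for all $A\in\mathcal B$. $\mathbb S^\nu$ is the space of real symmetric $\nu\times\nu$ matrices and $\mathbb S_+^\nu$ its cone of positive semi-definite matrices; $M\succeq0$ (resp. $M\succ 0$) means positive semi-definite (resp. positive definite). $\Delta=\{\delta\in\mathbb R^L:\delta_\ell\ge0,\ \sum_{\ell=1}^L\delta_\ell=1\}$. $\mathbb R_+^J$ is the non-negative orthant. A real polynomial in $v\in\mathbb R^m$ is SOS if it is a finite sum of squares of real polynomials; $\Sigma_d^2(v)$ is the set of SOS polynomials in $v$ of degree at most $d$. A real polynomial $f$ on $\mathbb R^m$ is SOS-convex if its Hessian $H(v)$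 equals $P(v)^\top P(v)$ for some $s\times m$ matrix $P(v)$ with polynomial entries and some $s\in\mathbb N$. $\min\text{(P)}$ and $\max\text{(D)}$ denote the minimum value of (P) and the maximum value of (D). *)

(* Defs.v *)
From HB Require Import structures.
From mathcomp Require Import all_boot all_order all_algebra.
From mathcomp Require Import all_classical all_reals all_analysis.
(* The notations of mpoly clash with those of MathComp-Analysis, so only its
   definitions are imported: [mpoly m R] is {mpoly R[m]}, [mderiv i p] is
   p^`M(i), [mpolyC m c] is c%:MP, [mpolyX R (mnm1 i)] is 'X_i and
   [mmeasure mdeg p] is msize p. *)
From mathcomp Require Import -(notations) mpoly.

Set Implicit Arguments.
Unset Strict Implicit.
Unset Printing Implicit Defensive.

Import Order.TTheory GRing.Theory Num.Theory.
Import numFieldNormedType.Exports.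

Local Open Scope classical_set_scope.
Local Open Scope ring_scope.

Section Matrices.
Context {R : realType} {m N nu : nat}.

Definition psd (A : 'M[R]_nu) : Prop :=
  A \is symmetricmx /\ forall x : 'cV[R]_nu, 0 <= (x^T *m A *m x) 0 0.

Definition pd (A : 'M[R]_nu) : Prop :=
  A \is symmetricmx /\ forall x : 'cV[R]_nu, x != 0 -> 0 < (x^T *m A *m x) 0 0.

Variables (F0 : 'M[R]_nu) (F : 'I_m -> 'M[R]_nu) (M : 'I_N -> 'M[R]_nu).

Definition lmi (v : 'rV[R]_m) (xi : 'rV[R]_N) : 'M[R]_nu :=
  F0 + \sum_i v 0 i *: F i + \sum_t xi 0 t *: M t.

Definition Omega : set 'rV[R]_m := [set v | exists xi, psd (lmi v xi)].

Definition slater : Prop := exists v xi, pd (lmi v xi).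

Lemma Omega_nonempty : slater -> Omega !=set0.
Proof.
move=> [v [xi [sym pos]]]; exists v, xi; split=> // x.
by have [->|x0] := eqVneq x 0; [rewrite mulmx0 mxE | exact/ltW/pos].
Qed.

End Matrices.

Section BorelSubset.
Context {T : topologicalType} {A : set T}.

(* [set_type A] carries the subspace topology.  MathComp-Analysis requires
   measurable types to be pointed, hence the nonemptiness witness. *)
Definition pointed_subset (A0 : A !=set0) : Type := set_type A.

HB.instance Definition _ (A0 : A !=set0) :=
  Topological.copy (pointed_subset A0) (set_type A).
HB.instance Definition _ (A0 : A !=set0) :=
  isPointed.Build (pointed_subset A0)
    (SigSub (mem_set (projT2 (cid A0))) : set_type A).

Definition borel_subset (A0 : A !=set0) : Type :=
  g_sigma_algebraType (@open (pointed_subset A0)).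

HB.instance Definition _ (A0 : A !=set0) := Measurable.on (borel_subset A0).

End BorelSubset.

Section SignedIntegral.
Context d (T : measurableType d) (R : realType).
Variable mu : {charge set T -> \bar R}.

Definition hahn_pos : set T := projT1 (cid (Hahn_decomposition mu)).
Definition hahn_neg : set T :=
  projT1 (cid (projT2 (cid (Hahn_decomposition mu)))).
Definition hahnP : hahn_decomposition mu hahn_pos hahn_neg :=
  projT2 (cid (projT2 (cid (Hahn_decomposition mu)))).

(* The Hahn decomposition is unique up to null sets, so neither the total
   variation (on measurable sets) nor the integral depends on its choice. *)
Definition tvar : set T -> \bar R := charge_variation hahnP.

(* Meaningful when f is integrable with respect to [tvar], in particular for
   f bounded and measurable. *)
Definition cintegral (f : T -> R) : R :=
  Rintegral (jordan_pos hahnP) setT f - Rintegral (jordan_neg hahnP) setT f.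

Definition cnonneg : Prop :=
  forall B : set T, measurable B -> (0 <= mu B)%E.

End SignedIntegral.

Section RegularBorel.
Context {R : realType} {T : topologicalType} {A : set T} (A0 : A !=set0).

Local Notation charges := ({charge set (borel_subset A0) -> \bar R}).

Definition cregular (mu : charges) : Prop :=
  forall B : set (borel_subset A0), measurable B ->
    tvar mu B = ereal_inf [set tvar mu U | U in
      [set U : set A | open U /\ B `<=` U]] /\
    tvar mu B = ereal_sup [set tvar mu K | K in
      [set K : set A | compact K /\ K `<=` B]].

(* The elements of the space X of finite signed regular Borel measures on A
   that are nonnegative on every Borel set. *)
Definition nonneg_measures : set charges :=
  [set mu | cregular mu /\ cnonneg mu].

(* The integral over A of (the restriction to A of) a function f on T. *)
Definition integral_on (mu : charges)
    (f : T -> R) : R :=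
  cintegral mu (fun x : borel_subset A0 => f (set_val (x : set_type A))).

End RegularBorel.

Section Polynomials.
Context {R : realType} {m : nat}.
Implicit Types p : mpoly m R.

Definition peval p (v : 'rV[R]_m) : R := meval (fun i => v 0 i) p.

(* mmeasure mdeg p is 1 + the degree of p, and 0 if p = 0; hence the zero
   polynomial gets degree 0 here. *)
Definition pdeg p : nat := (mmeasure mdeg p).-1.

Definition sos p : Prop := exists qs : seq (mpoly m R), p = \sum_(q <- qs) q ^+ 2.

Definition Sigma2 (d : nat) : set (mpoly m R) :=
  [set p | sos p /\ (pdeg p <= d)%N].

Definition hessian p : 'M[mpoly m R]_m := \matrix_(i, j) mderiv i (mderiv j p).

Definition sos_convex p : Prop :=
  exists (s : nat) (P : 'M[mpoly m R]_(s, m)), hessian p = P^T *m P.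

End Polynomials.

Section Optimization.
Context {R : realType}.

Definition is_minimum (S : set R) (c : R) : Prop := S c /\ lbound S c.
Definition is_maximum (S : set R) (c : R) : Prop := S c /\ ubound S c.

Definition minI n (f : 'I_n.+1 -> R) : R := \big[Num.min/f ord0]_(k < n.+1) f k.
Definition maxI n (f : 'I_n.+1 -> R) : R := \big[Num.max/f ord0]_(k < n.+1) f k.

Definition simplex n : set 'rV[R]_n :=
  [set w | (forall l, 0 <= w 0 l) /\ \sum_l w 0 l = 1].

Definition orthant n : set 'rV[R]_n := [set w | forall j, 0 <= w 0 j].

End Optimization.
Arguments simplex {R} n.
Arguments orthant {R} n.

(* r.+1 and L.+1 stand for the (positive) numbers r and L of the text;
   g k l is g_l^k. *)

Section Primal.
Context {R : realType} {m r L J : nat}.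
Context {A : set 'rV[R]_m} (A0 : A !=set0).
Variables (g : 'I_r.+1 -> 'I_L.+1 -> mpoly m R) (h : 'I_J -> mpoly m R).
Variable gamma : 'rV[R]_J.

Local Notation charges := ({charge set (borel_subset A0) -> \bar R}).

Definition primal_obj (mu : charges) : R :=
  integral_on mu (fun v => minI (fun k => maxI (fun l => peval (g k l) v))).

Definition primal_feasible : set charges :=
  [set mu | [/\ nonneg_measures mu,
    forall j, integral_on mu (peval (h j)) <= gamma 0 j &
    integral_on mu (fun=> 1) = 1]].

Definition primal_values : set R :=
  [set primal_obj mu | mu in primal_feasible].

Definition moments (mu : charges) : 'rV[R]_(J + 1) :=
  row_mx (\row_j integral_on mu (peval (h j)))
         (const_mx (integral_on mu (fun=> 1))).

Definition moment_cone : set 'rV[R]_(J + 1) :=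
  [set x + y | x in [set moments mu | mu in nonneg_measures (A0 := A0)] &
               y in [set row_mx s 0 | s in orthant J]].

End Primal.
Arguments primal_obj {R m r L A} A0 g mu.
Arguments primal_feasible {R m J A} A0 h gamma.
Arguments primal_values {R m r L J A} A0 g h gamma.
Arguments moment_cone {R m J A} A0 h.

Section Dual.
Context {R : realType} {m N nu r L J : nat}.
Variables (F0 : 'M[R]_nu) (F : 'I_m -> 'M[R]_nu) (M : 'I_N -> 'M[R]_nu).
Variables (g : 'I_r.+1 -> 'I_L.+1 -> mpoly m R) (h : 'I_J -> mpoly m R).
Variables (gamma : 'rV[R]_J) (d : nat).

Definition least_even_degree_bound : Prop :=
  let bound e := [/\ ~~ odd e, forall k l, (pdeg (g k l) <= e)%N &
                     forall j, (pdeg (h j) <= e)%N] in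
  bound d /\ forall e, bound e -> (d <= e)%N.

(* The multiplier lambda of the text is the pair of lam and lam0, the latter
   being its last component. *)
Definition dual_obj (lam : 'rV[R]_J) (lam0 : R) : R :=
  - (\sum_j lam 0 j * gamma 0 j) - lam0.

Definition dual_poly (lam : 'rV[R]_J) (lam0 : R) (Z : 'M[R]_nu)
    (delta : 'rV[R]_L.+1) (k : 'I_r.+1) : mpoly m R :=
  \sum_l delta 0 l *: g k l + \sum_j lam 0 j *: h j + mpolyC m lam0
  - mpolyC m (\tr (Z *m F0))
  - \sum_i \tr (Z *m F i) *: mpolyX R (mnm1 i).

Definition dual_feasible (lam : 'rV[R]_J) (lam0 : R)
    (Z : 'I_r.+1 -> 'M[R]_nu) (delta : 'I_r.+1 -> 'rV[R]_L.+1) : Prop :=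
  orthant J lam /\
  forall k, [/\ psd (Z k), simplex L.+1 (delta k),
    Sigma2 d (dual_poly lam lam0 (Z k) (delta k) k) &
    forall t, \tr (Z k *m M t) = 0].

Definition dual_values : set R :=
  [set y | exists lam lam0 Z delta,
     dual_feasible lam lam0 Z delta /\ y = dual_obj lam lam0].

End Dual.

(* Main.v *)
Require Import Defs.
From HB Require Import structures.
From mathcomp Require Import all_boot all_order all_algebra.
From mathcomp Require Import all_classical all_reals all_analysis.
From mathcomp Require Import -(notations) mpoly.
From mathcomp Require Import measurable_realfun ring lra polyrcf.

Set Implicit Arguments.
Unset Strict Implicit.
Unset Printing Implicit Defensive.

Import Order.TTheory GRing.Theory Num.Theory.
Import numFieldNormedType.Exports.

Local Open Scope classical_set_scope.
Local Open Scope ring_scope.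

(** Weak duality is integration.  On Omega the affine function
    tr (Z F0) + \sum_i v_i tr (Z F_i) equals tr (Z lmi v xi) for any xi that
    witnesses v in Omega, because tr (Z M_t) = 0; hence it is nonnegative, so a
    dual feasible point gives
    min_k max_l g_l^k + \sum_j lam_j h_j + lam0 >= 0 on Omega
    (dual_feasible_lower_bound), and integrating against a feasible measure
    bounds its objective from below (dual_objective_le).

    For the converse let c be the primal minimum.  A separating hyperplane in
    moment space yields multipliers lam >= 0 and lam0 with dual objective at
    least c for which the same inequality holds at every point of Omega
    (moment_multipliers).  Only finite sums of point masses have to be
    constructed for this.

    Fix k.  On Omega the maximum over l of the convex functions
    g_l^k + \sum_j lam_j h_j + lam0 is nonnegative, and Omega is the projection of
    a set cut out by a linear matrix inequality with a Slater point.  A second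
    separation produces the convex weights delta^k and the matrix Z_k together,
    such that the k-th dual polynomial is nonnegative on the whole space and
    tr (Z_k M_t) = 0 (conic_multipliers).

    This polynomial is SOS-convex, so it remains to see that a nonnegative
    SOS-convex polynomial p is a sum of squares (sos_convex_nonneg_sos).  The
    factorization of the Hessian makes the second order Taylor remainder at any
    point y a sum of squares (sos_convex_taylor); p attains its minimum, although
    it need not be coercive (sos_convex_attains), and at a minimizer the linear
    term vanishes. *)

(** * Separation of a point from a convex set *)

Section Separation.
Context {R : realType}.

Definition dot n (u v : 'rV[R]_n) : R := \sum_i u 0 i * v 0 i.

Lemma dotDr n (u v w : 'rV[R]_n) : dot u (v + w) = dot u v + dot u w.
Proof. by rewrite -big_split; apply: eq_bigr => i _; rewrite mxE mulrDr. Qed.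

Lemma dotZr n a (u v : 'rV[R]_n) : dot u (a *: v) = a * dot u v.
Proof. by rewrite mulr_sumr; apply: eq_bigr => i _; rewrite mxE mulrCA. Qed.

Lemma dotZl n a (u v : 'rV[R]_n) : dot (a *: u) v = a * dot u v.
Proof. by rewrite mulr_sumr; apply: eq_bigr => i _; rewrite mxE mulrA. Qed.

Lemma dotNr n (u v : 'rV[R]_n) : dot u (- v) = - dot u v.
Proof. by rewrite -scaleN1r dotZr mulN1r. Qed.

Lemma dot0r n (u : 'rV[R]_n) : dot u 0 = 0.
Proof. by rewrite -(scale0r 0) dotZr mul0r. Qed.

Lemma dot0l n (u : 'rV[R]_n) : dot 0 u = 0.
Proof. by rewrite -(scale0r 0) dotZl mul0r. Qed.

Lemma dot_row_mx n1 n2 (u1 v1 : 'rV[R]_n1) (u2 v2 : 'rV[R]_n2) :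
  dot (row_mx u1 u2) (row_mx v1 v2) = dot u1 v1 + dot u2 v2.
Proof.
rewrite /dot big_split_ord; congr (_ + _); apply: eq_bigr => i _.
  by rewrite !row_mxEl.
by rewrite !row_mxEr.
Qed.

Lemma dot_scalar (a b : R) : dot a%:M b%:M = a * b.
Proof. by rewrite /dot big_ord1 !mxE eqxx !mulr1n. Qed.

Lemma dot_delta n (u : 'rV[R]_n) i : dot u (delta_mx 0 i) = u 0 i.
Proof.
rewrite /dot (bigD1 i)//= mxE !eqxx mulr1 big1 ?addr0// => j ji.
by rewrite mxE (negPf ji) mulr0.
Qed.

Lemma ray_ge0 (c d : R) : (forall s, 0 <= s -> 0 <= c + s * d) -> 0 <= d.
Proof.
move=> cd; rewrite leNgt; apply/negP => d0.
have /cd : 0 <= (`|c| + 1) / - d by rewrite divr_ge0 ?oppr_ge0 ?ltW.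
rewrite invrN mulrN mulNr divfK ?lt_eqF//.
by have := ler_norm c; lra.
Qed.

Lemma line_eq0 (c d : R) : (forall s, 0 <= c + s * d) -> d = 0.
Proof.
move=> cd; apply/eqP; rewrite eq_le -[leLHS]opprK oppr_le0; apply/andP; split.
  by apply: (@ray_ge0 c) => s _; have := cd (- s); rewrite mulrN mulNr.
by apply: (@ray_ge0 c) => s _.
Qed.

Lemma lt_comb (a b x x' y y' : R) : 0 <= a -> 0 <= b -> a + b = 1 ->
  x < y -> x' < y' -> a * x + b * x' < a * y + b * y'.
Proof.
move=> a0 b0 ab xy xy'; have [a_eq0|a_neq0] := eqVneq a 0.
  by rewrite a_eq0 add0r in ab *; rewrite ab !mul0r !add0r !mul1r.
apply: ltr_leD; first by rewrite ltr_pM2l// lt_def a_neq0.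
exact/ler_wpM2l/ltW.
Qed.

Lemma dot_gt0 n (u : 'rV[R]_n) : u != 0 -> 0 < dot u u.
Proof.
move=> /rV0Pn[i ui]; rewrite /dot (bigD1 i)//= ltr_pwDl//.
  by rewrite -expr2 exprn_even_gt0.
by apply: sumr_ge0 => j _; rewrite -expr2 sqr_ge0.
Qed.

Definition convex (V : lmodType R) (C : set V) : Prop :=
  forall x y a b, C x -> C y -> 0 <= a -> 0 <= b -> a + b = 1 ->
    C (a *: x + b *: y).

Definition affine (V : lmodType R) (f : V -> R) : Prop :=
  forall x y a b, a + b = 1 -> f (a *: x + b *: y) = a * f x + b * f y.

(** The two-dimensional case: the image of C under (f, g) misses the open left
    half-line of the horizontal axis, so some closed half-plane through the
    origin contains it.  Either its boundary has a finite slope t, or it is the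
    vertical axis turned to one of the two sides. *)
Lemma pencil_nonneg (V : lmodType R) (C : set V) (f g : V -> R) :
  convex C -> affine f -> affine g ->
  (forall x, C x -> g x = 0 -> 0 <= f x) ->
  [\/ exists t, forall x, C x -> 0 <= f x + t * g x,
      forall x, C x -> 0 <= g x | forall x, C x -> 0 <= - g x].
Proof.
move=> Cc ff fg fg0.
have [gn|/existsNP[y /not_implyP[Cy /negP]]] :=
  pselect (forall x, C x -> 0 <= g x); first exact: Or32.
rewrite -ltNge => gy.
have [gp|/existsNP[z /not_implyP[Cz /negP]]] :=
  pselect (forall x, C x -> 0 <= - g x); first exact: Or33.
rewrite -ltNge oppr_lt0 => gz; apply: Or31.
(* The admissible slopes t are those above every - f x / g x with g x > 0 and
   below every f y / - g y with g y < 0. *)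
have key x1 x2 : C x1 -> C x2 -> 0 < g x1 -> g x2 < 0 ->
    - f x1 / g x1 <= f x2 / - g x2.
  move=> C1 C2 g1 g2; rewrite ler_pdivrMr// mulrAC ler_pdivlMr ?oppr_gt0//.
  have s0 : 0 < g x1 - g x2 by lra.
  have ab1 : - g x2 / (g x1 - g x2) + g x1 / (g x1 - g x2) = 1.
    by rewrite -mulrDl addrC divff// gt_eqF.
  have a0 : 0 <= - g x2 / (g x1 - g x2).
    by rewrite divr_ge0 ?oppr_ge0 ?(ltW g2) ?(ltW s0).
  have b0 : 0 <= g x1 / (g x1 - g x2) by rewrite divr_ge0 ?(ltW g1) ?(ltW s0).
  have := @fg0 _ (Cc x1 x2 _ _ C1 C2 a0 b0 ab1); rewrite ff// fg//.
  rewrite ![_ / _ * _]mulrAC -!mulrDl.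
  have -> : - g x2 * g x1 + g x1 * g x2 = 0 by ring.
  by rewrite mul0r pmulr_lge0 ?invr_gt0// => /(_ erefl); lra.
pose S := [set - f x / g x | x in [set x | C x /\ 0 < g x]].
have Sub w : C w -> g w < 0 -> ubound S (f w / - g w).
  by move=> Cw gw _ [x [Cx gx] <-]; exact: key.
have S0 : S !=set0 by exists (- f z / g z), z.
have Ss : has_sup S by split=> //; exists (f y / - g y); exact: Sub.
exists (sup S) => x Cx; have [gx|gx|gx] := ltrgtP (g x) 0.
- have := ge_sup S0 (Sub x Cx gx); rewrite ler_pdivlMr ?oppr_gt0//; lra.
- have : - f x / g x <= sup S by apply: ub_le_sup; [exact: Ss.2|exists x].
  by rewrite ler_pdivrMr//; lra.
- by rewrite gx mulr0 addr0; exact: fg0.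
Qed.

(** The separating functional is built one coordinate at a time: the slice of C
    by the hyperplane where the first coordinate vanishes is separated from 0 by
    induction, and pencil_nonneg tilts this functional so that it is nonnegative
    on all of C.  Only the order completeness of R enters, and C need not be
    closed. *)
Lemma separation n (C : set 'rV[R]_n.+1) : convex C -> ~ C 0 ->
  exists2 phi : 'rV[R]_n.+1, phi != 0 & forall x, C x -> 0 <= dot phi x.
Proof.
elim: n C => [|n IHn] C.
  move=> Cc C0.
  (* With f = -1 the first alternative gives t <> 0 as soon as C is nonempty. *)
  have [|||[t tC]|Cp|Cn] := @pencil_nonneg _ C (fun=> -1) (fun x => x 0 0) Cc.
  - by move=> x y a b ab; rewrite -mulrDl ab mul1r.
  - by move=> x y a b _; rewrite !mxE.
  - move=> x Cx x0; case: C0; suff <- : x = 0 by [].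
    by apply/rowP => i; rewrite ord1 x0 mxE.
  - have [t0|t0] := eqVneq t 0.
      exists (const_mx 1) => [|x /tC].
        by apply/rV0Pn; exists 0; rewrite mxE oner_neq0.
      by rewrite t0; lra.
    exists (const_mx t) => [|x /tC]; first by apply/rV0Pn; exists 0; rewrite mxE.
    by rewrite /dot big_ord1 mxE; lra.
  - exists (const_mx 1) => [|x /Cp].
      by apply/rV0Pn; exists 0; rewrite mxE oner_neq0.
    by rewrite /dot big_ord1 mxE mul1r.
  - exists (const_mx (-1)) => [|x /Cn].
      by apply/rV0Pn; exists 0; rewrite mxE oppr_eq0 oner_neq0.
    by rewrite /dot big_ord1 mxE mulN1r.
rewrite -[n.+2]/(1 + n.+1)%N in C * => Cc C0.
pose hd (x : 'rV[R]_(1 + n.+1)) := x 0 (lshift n.+1 0).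
have hdE a (y : 'rV[R]_n.+1) : hd (row_mx a%:M y) = a.
  by rewrite /hd row_mxEl mxE eqxx.
have rowE (x : 'rV[R]_(1 + n.+1)) : x = row_mx (hd x)%:M (rsubmx x).
  rewrite -[LHS]hsubmxK; congr row_mx.
  by apply/rowP => i; rewrite ord1 !mxE eqxx mulr1n.
have [||phi phi0 phiC] := IHn [set y | C (row_mx 0 y)].
- move=> x y a b /= Cx Cy a0 b0 ab; have := Cc _ _ _ _ Cx Cy a0 b0 ab.
  by rewrite !scale_row_mx add_row_mx !scaler0 addr0.
- by rewrite /= row_mx0.
have [|||[t tC]|Cp|Cn] :=
  @pencil_nonneg _ C (fun x => dot phi (rsubmx (x : 'rV_(1 + n.+1)))) hd Cc.
- by move=> x y a b _; rewrite linearD !linearZ/= dotDr !dotZr.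
- by move=> x y a b _; rewrite /hd !mxE.
- move=> x Cx x0; apply: phiC => /=.
  by move: Cx; rewrite [x in C x]rowE x0 raddf0.
- exists (row_mx t%:M phi).
    apply: contra phi0 => /eqP e0; apply/eqP.
    by rewrite -(row_mxKr t%:M phi) [row_mx _ _]e0 linear0.
  move=> x /tC; rewrite [X in dot (row_mx _ _) X]rowE (@dot_row_mx 1) dot_scalar.
  by rewrite addrC.
- exists (row_mx 1%:M 0).
    by apply/rV0Pn; exists (lshift n.+1 0); rewrite row_mxEl mxE oner_neq0.
  move=> x /Cp; rewrite [X in dot (row_mx _ _) X]rowE (@dot_row_mx 1) dot_scalar.
  by rewrite dot0l addr0 mul1r.
- exists (row_mx (-1)%:M 0).
    by apply/rV0Pn; exists (lshift n.+1 0); rewrite row_mxEl mxE oppr_eq0 oner_neq0.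
  move=> x /Cn; rewrite [X in dot (row_mx _ _) X]rowE (@dot_row_mx 1) dot_scalar.
  by rewrite dot0l addr0 mulN1r.
Qed.

(** From an interior point one can still move a little in the direction - u,
    which strictly lowers the value of dot u. *)
Lemma interior_dot_gt0 n (K : set 'rV[R]_n) (u p : 'rV[R]_n) :
  u != 0 -> K° p -> (forall x, K x -> 0 <= dot u x) -> 0 < dot u p.
Proof.
move=> u0 Kp uK; pose f (t : R) : 'rV[R]_n := p + t *: (- u).
have fc : {for 0, continuous f}.
  apply: continuousD; first exact: cst_continuous.
  exact: scalel_continuous.
have /fc/nbhs_ballP[e /= e0 eK] : nbhs (f 0) K by rewrite /f scale0r addr0.
have : K (f (e / 2)).
  by apply: eK; rewrite /ball/= sub0r normrN gtr0_norm; lra.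
move=> /uK; rewrite dotDr dotZr dotNr.
have := mulr_gt0 (divr_gt0 e0 (ltr0n _ 2)) (dot_gt0 u0); lra.
Qed.

End Separation.

(** * Positive semidefinite matrices *)

Section PsdMatrices.
Context {R : realType}.

Lemma symmx_tr n (A : 'M[R]_n) : (A \is symmetricmx) = (A^T == A).
Proof.
by rewrite is_hermitianmxE expr0 scale1r map_mx_id// eq_sym.
Qed.

Lemma quad_row n p (A : 'M[R]_n) (B : 'M[R]_(p, n)) i :
  (B *m A *m B^T) i i = ((row i B)^T^T *m A *m (row i B)^T) 0 0.
Proof.
by rewrite trmxK -row_mul !mxE; apply: eq_bigr => j _; rewrite !mxE.
Qed.

Lemma psd_gram_block n (a : R) (u : 'cV[R]_n) (D : 'M[R]_n) (t : R) y :
  ((col_mx t%:M y)^T *m block_mx a%:M u^T u D *m col_mx t%:M y) 0 0 =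
  a * t ^+ 2 + 2 * t * (u^T *m y) 0 0 + (y^T *m D *m y) 0 0.
Proof.
have yu : (y^T *m u) 0 0 = (u^T *m y) 0 0.
  by rewrite -[in LHS](trmxK u) -trmx_mul [LHS]mxE.
rewrite tr_col_mx tr_scalar_mx mul_row_block mul_row_col !mulmxDl.
rewrite -!scalar_mxM mul_scalar_mx -scalemxAl mul_mx_scalar.
rewrite [LHS]mxE [X in X + _]mxE [X in _ + X]mxE [X in _ + X + _]mxE yu.
rewrite [X in _ + (X + _)]mxE mxE eqxx mulr1n; ring.
Qed.

(** Cholesky factorization, by induction on the size: if the corner entry a is
    positive then completing the square leaves a psd Schur complement; if a = 0
    then the rest u of its column vanishes too. *)
Lemma psd_gram n (A : 'M[R]_n) : psd A -> exists B : 'M[R]_n, A = B^T *m B.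
Proof.
elim: n A => [|n IHn] A [/[!symmx_tr] /eqP As Ap].
  by exists 0; apply/matrixP => -[].
rewrite -[n.+1]/(1 + n)%N in A As Ap *.
pose a := A (lshift n 0) (lshift n 0); pose u := dlsubmx A; pose D := drsubmx A.
have AE : A = block_mx a%:M u^T u D.
  rewrite -[LHS]submxK; congr block_mx.
    by apply/matrixP => i j; rewrite !ord1 !mxE eqxx mulr1n.
  by rewrite /u trmx_dlsub As.
have DT : D^T = D by rewrite /D trmx_drsub As.
have Aq t (y : 'cV[R]_n) :
    0 <= a * t ^+ 2 + 2 * t * (u^T *m y) 0 0 + (y^T *m D *m y) 0 0.
  by have := Ap (col_mx t%:M y); rewrite AE psd_gram_block.
have a0 : 0 <= a.
  by have := Aq 1 0; rewrite !mulmx0 !mxE; lra.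
have uu : (u^T *m u) 0 0 = \sum_i u i 0 ^+ 2.
  by rewrite mxE; apply: eq_bigr => i _; rewrite !mxE.
have [a_eq0|a_neq0] := eqVneq a 0.
  have u0 : u = 0.
    suff uu0 : (u^T *m u) 0 0 <= 0.
      apply/colP => i; rewrite [RHS]mxE; apply/eqP; rewrite -sqrf_eq0 eq_le.
      rewrite sqr_ge0 andbT (le_trans _ uu0)// uu (bigD1 i)//= lerDl.
      by apply: sumr_ge0 => j _; exact: sqr_ge0.
    rewrite leNgt; apply/negP => uu0; set w := (u^T *m u) 0 0 in uu0.
    set v := (u^T *m D *m u) 0 0.
    (* The form is affine in t when a = 0; this t makes it take the value -1. *)
    have := Aq (- (v + 1) / (2 * w)) u; rewrite a_eq0 mul0r add0r -/w -/v.
    suff -> : 2 * (- (v + 1) / (2 * w)) * w = - (v + 1) by lra.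
    by field; rewrite gt_eqF.
  have [|B DB] := IHn D.
    split=> [|y]; first by rewrite symmx_tr DT.
    by have := Aq 0 y; rewrite expr0n !(mulr0, mul0r, add0r).
  exists (block_mx 0 0 0 B); rewrite AE a_eq0 u0 DB tr_block_mx mulmx_block.
  by rewrite !trmx0 !(mulmx0, mul0mx, addr0) add0r raddf0.
have {}a0 : 0 < a by rewrite lt_def a_neq0.
have sa0 : Num.sqrt a != 0 by rewrite sqrtr_eq0 -ltNge.
have sa2 : Num.sqrt a * Num.sqrt a = a by rewrite -expr2 sqr_sqrtr// ltW.
have [|B DB] := IHn (D - a^-1 *: (u *m u^T)).
  split=> [|y].
    by rewrite symmx_tr linearB linearZ/= DT trmx_mul trmxK.
  set w := (u^T *m y) 0 0.
  have yu : (y^T *m u) 0 0 = w by rewrite -[in LHS](trmxK u) -trmx_mul mxE.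
  have -> : (y^T *m (D - a^-1 *: (u *m u^T)) *m y) 0 0 =
      (y^T *m D *m y) 0 0 - a^-1 * w ^+ 2.
    rewrite mulmxBr mulmxBl -scalemxAr -scalemxAl mxE; congr (_ + _).
    rewrite [LHS]mxE; congr (- _); rewrite [LHS]mxE.
    rewrite mulmxA -(mulmxA (y^T *m u)); congr (_ * _).
    rewrite [LHS]mxE big_ord1 yu -/w.
    by rewrite expr2.
  (* The form is least in t at t = - w / a. *)
  have := Aq (- w / a) y; rewrite -/w.
  suff -> : a * (- w / a) ^+ 2 + 2 * (- w / a) * w = - (a^-1 * w ^+ 2).
    by rewrite addrC.
  by field.
exists (block_mx (Num.sqrt a)%:M ((Num.sqrt a)^-1 *: u^T) 0 B).
rewrite AE tr_block_mx mulmx_block -DB !trmx0 tr_scalar_mx.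
rewrite !(mulmx0, mul0mx, addr0) -scalar_mxM sa2; congr block_mx.
- by rewrite mul_scalar_mx scalerA divff// scale1r.
- by rewrite mul_mx_scalar [(_ *: _)^T]linearZ/= trmxK scalerA divff// scale1r.
- rewrite [(_ *: _)^T]linearZ/= trmxK -scalemxAl -scalemxAr scalerA -invfM sa2.
  by rewrite addrC subrK.
Qed.

Lemma psd_trace_ge0 n (Z A : 'M[R]_n) : psd Z -> psd A -> 0 <= \tr (Z *m A).
Proof.
move=> [_ Zp] /psd_gram[B ->]; rewrite mulmxA mxtrace_mulC mulmxA.
by apply: sumr_ge0 => i _; rewrite quad_row.
Qed.

Lemma psd_trace_le0_eq0 n (Z A : 'M[R]_n) :
  psd Z -> pd A -> \tr (Z *m A) <= 0 -> Z = 0.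
Proof.
move=> /psd_gram[B ->] [_ Ap]; rewrite -mulmxA mxtrace_mulC => tr0.
suff -> : B = 0 by rewrite mulmx0.
have q_ge0 (x : 'cV[R]_n) : 0 <= (x^T *m A *m x) 0 0.
  by have [->|x0] := eqVneq x 0; [rewrite mulmx0 mxE | exact/ltW/Ap].
apply/row_matrixP => i; rewrite row0; apply/eqP/negPn/negP => Bi.
have : 0 < \tr (B *m A *m B^T).
  rewrite /mxtrace (bigD1 i)//= ltr_pwDl//.
    by rewrite quad_row Ap// trmx_eq0.
  by apply: sumr_ge0 => j _; rewrite quad_row.
by rewrite ltNge tr0.
Qed.

Lemma rank1_psd n (x : 'cV[R]_n) : psd (x *m x^T).
Proof.
split=> [|y]; first by rewrite symmx_tr trmx_mul trmxK.
rewrite mulmxA -(mulmxA (y^T *m x)) -[y^T *m x]trmxK trmx_mul trmxK.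
rewrite mxE big_ord1 mxE -expr2.
exact: sqr_ge0.
Qed.

End PsdMatrices.

(** * The Taylor remainder of an SOS-convex polynomial *)

Section SumsOfSquares.
Context {R : realType} {m : nat}.
Local Notation A := (mpoly m R).
Implicit Types p q : A.

Lemma sos0 : sos (0 : A).
Proof. by exists [::]; rewrite big_nil. Qed.

Lemma sosD p q : sos p -> sos q -> sos (p + q).
Proof. by move=> [s ->] [t ->]; exists (s ++ t); rewrite big_cat. Qed.

Lemma sos_sqr p : sos (p ^+ 2).
Proof. by exists [:: p]; rewrite big_seq1. Qed.

Lemma sos_sum I (s : seq I) (P : pred I) (F : I -> A) :
  (forall i, P i -> sos (F i)) -> sos (\sum_(i <- s | P i) F i).
Proof. by move=> FP; elim/big_ind: _; [exact: sos0|exact: sosD|]. Qed.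

Lemma sosC (c : R) : 0 <= c -> sos (mpolyC m c).
Proof.
move=> c0; exists [:: mpolyC m (Num.sqrt c)].
by rewrite big_seq1 -rmorphXn/= sqr_sqrtr.
Qed.

Lemma sos_quadratic_form n (C : 'M[R]_n) (q : 'I_n -> A) :
  psd C -> sos (\sum_i \sum_j C i j *: (q i * q j)).
Proof.
move=> /psd_gram[B ->].
suff -> : \sum_i \sum_j (B^T *m B) i j *: (q i * q j) =
    \sum_k (\sum_i B k i *: q i) ^+ 2.
  by apply: sos_sum => k _; exact: sos_sqr.
under eq_bigr => i _.
  under eq_bigr => j _ do rewrite mxE scaler_suml.
  rewrite exchange_big; over.
rewrite exchange_big; apply: eq_bigr => k _.
rewrite expr2 mulr_suml; apply: eq_bigr => i _.
rewrite mulr_sumr; apply: eq_bigr => j _.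
by rewrite mxE -scalerAl -scalerAr scalerA.
Qed.

Lemma poly_ge0_of_deriv (P : {poly R}) :
  P.[0] = 0 -> (forall x, 0 <= x -> 0 <= P^`().[x]) ->
  forall x, 0 <= x -> 0 <= P.[x].
Proof.
move=> P0 dP x; rewrite le_eqVlt => /predU1P[<-|x0]; first by rewrite P0.
have [c] := poly_mvt P x0; rewrite P0 !subr0 => /itvP cx ->.
by rewrite mulr_ge0 ?dP ?cx// ltW.
Qed.

(** The weights are the moments of (1 - s) ds on [0, 1], namely
    1 / ((k + 1) (k + 2)), which appear in the integral form of the remainder of
    order two. *)
Definition taylor_weight k : R := (k.+1%:R * k.+2%:R)^-1.

(** The quadratic form is the integral of (1 - s) (\sum_i x_i s^i)^2 over [0, 1].
    Integrating by parts, it is the value at 1 of the second antiderivative of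
    this square, so two applications of the mean value theorem give its sign. *)
Lemma taylor_weight_psd n : psd (\matrix_(i < n, j < n) taylor_weight (i + j)).
Proof.
split=> [|x].
  by rewrite symmx_tr; apply/eqP/matrixP => i j; rewrite !mxE addnC.
pose P1 : {poly R} := \sum_(i < n) \sum_(j < n)
  (x i 0 * x j 0 / (i + j).+1%:R) *: 'X^((i + j).+1).
pose P2 : {poly R} := \sum_(i < n) \sum_(j < n)
  (x i 0 * x j 0 * taylor_weight (i + j)) *: 'X^((i + j).+2).
have nz k : k.+1%:R != 0 :> R by rewrite pnatr_eq0.
have dP1 : P1^`() = (\sum_(i < n) x i 0 *: 'X^i) ^+ 2.
  rewrite expr2 mulr_suml linear_sum; apply: eq_bigr => i _.
  rewrite mulr_sumr linear_sum; apply: eq_bigr => j _.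
  rewrite linearZ/= derivXn -scalerMnr scalerMnl -mulr_natr divfK// exprD.
  by rewrite -scalerAl -scalerAr scalerA.
have dP2 : P2^`() = P1.
  rewrite linear_sum; apply: eq_bigr => i _.
  rewrite linear_sum; apply: eq_bigr => j _.
  rewrite linearZ/= derivXn -scalerMnr scalerMnl -mulr_natr; congr (_ *: _).
  by rewrite /taylor_weight invfM [_ * (_ / _)]mulrA divfK.
have z0 c k : (c *: 'X^(k.+1) : {poly R}).[0] = 0.
  by rewrite hornerZ hornerXn expr0n mulr0.
have P10 y : 0 <= y -> 0 <= P1.[y].
  apply: poly_ge0_of_deriv => [|z _]; last by rewrite dP1 horner_exp sqr_ge0.
  by rewrite horner_sum big1// => i _; rewrite horner_sum big1.
have <- : P2.[1] = (x^T *m (\matrix_(i, j) taylor_weight (i + j)) *m x) 0 0.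
  rewrite [RHS]mxE horner_sum; under eq_bigr => i _ do rewrite horner_sum.
  rewrite exchange_big; apply: eq_bigr => j _.
  rewrite mxE mulr_suml; apply: eq_bigr => i _.
  by rewrite hornerZ hornerXn expr1n mulr1 !mxE mulrAC.
apply: poly_ge0_of_deriv => [|z|//]; last by rewrite dP2; exact: P10.
by rewrite horner_sum big1// => i _; rewrite horner_sum big1.
Qed.

(** The remainder is the integral of (1 - s) P''(s) over [0, 1].  Its coefficientwise
    form Lam makes sense over any R-algebra; on a square it is a quadratic form
    in the coefficients, psd by taylor_weight_psd, hence a sum of squares. *)
Lemma sos_taylor_remainder (P : {poly A}) s (Q : 'I_s -> {poly A}) :
  P^`()^`() = \sum_r Q r ^+ 2 -> sos (P.[1] - P.[0] - P^`().[0]).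
Proof.
move=> PQ; pose N := (size P + \sum_r (size (Q r) + size (Q r)))%N.
pose Lam (S : {poly A}) : A := \sum_(k < N) taylor_weight k *: S`_k.
have LamD S T : Lam (S + T) = Lam S + Lam T.
  by rewrite -big_split; apply: eq_bigr => k _; rewrite coefD scalerDr.
have Lam0 : Lam 0 = 0 by rewrite /Lam big1// => k _; rewrite coef0 scaler0.
have LamS I (t : seq I) F : Lam (\sum_(i <- t) F i) = \sum_(i <- t) Lam (F i).
  by rewrite (big_morph Lam LamD Lam0).
have LamX a k : (k < N)%N -> Lam (a *: 'X^k) = taylor_weight k *: a.
  move=> kN; rewrite /Lam (bigD1 (Ordinal kN))//= coefZ coefXn eqxx mulr1.
  rewrite big1 ?addr0// => i ik; rewrite coefZ coefXn.
  by rewrite (_ : (_ == _) = false) ?mulr0 ?scaler0//; apply: negbTE.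
have -> : P.[1] - P.[0] - P^`().[0] = Lam P^`()^`().
  rewrite !horner_coef0 coef_deriv (@horner_coef_wide _ N.+2); last first.
    by rewrite /N -!addnS leq_addr.
  rewrite !big_ord_recl/= expr1n !mulr1 mulr1n.
  have -> (a b c : A) : a + (b + c) - a - b = c by ring.
  apply: eq_bigr => k _; rewrite expr1n mulr1 !coef_deriv /bump !leq0n !add1n.
  rewrite -mulrnA -scaler_nat scalerA natrM [X in _ * X]mulrC mulVf ?scale1r//.
rewrite PQ LamS; apply: sos_sum => r _.
have -> : Lam (Q r ^+ 2) = \sum_(i < size (Q r)) \sum_(j < size (Q r))
    (\matrix_(i < size (Q r), j < size (Q r)) taylor_weight (i + j)) i j
      *: ((Q r)`_i * (Q r)`_j).
  rewrite expr2 -[in LHS](coefK (Q r)) poly_def mulr_suml LamS.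
  apply: eq_bigr => i _; rewrite mulr_sumr LamS; apply: eq_bigr => j _.
  rewrite -scalerAl -scalerAr scalerA -exprD LamX ?mxE//.
  rewrite /N (bigD1 r)//=; apply: leq_trans (leq_addl _ _).
  by apply: leq_trans (leq_addr _ _); rewrite -addSn leq_add// ltnW.
exact/sos_quadratic_form/taylor_weight_psd.
Qed.

Lemma mpoly_alg_ind (P : A -> Prop) :
  (forall c, P (mpolyC m c)) -> (forall i, P (mpolyX R (mnm1 i))) ->
  (forall p q, P p -> P q -> P (p + q)) ->
  (forall p q, P p -> P q -> P (p * q)) -> forall p, P p.
Proof.
move=> PC PX PD PM; elim/mpolyind => [|c k p _ _ Pp].
  by rewrite -(rmorph0 (@mpolyC m R)); exact: PC.
apply: PD => //; rewrite -mul_mpolyC; apply: (PM) => //; rewrite mpolyXE_id.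
have P1 : P 1 by rewrite -(rmorph1 (@mpolyC m R)); exact: PC.
apply: big_rec => [//|i q _ Pq]; apply: (PM _ _ _ Pq).
by elim: (k i) => // n IHn; rewrite exprS; exact: PM.
Qed.

Lemma pevalD p q v : peval (p + q) v = peval p v + peval q v.
Proof. by rewrite /peval rmorphD. Qed.

Lemma pevalM p q v : peval (p * q) v = peval p v * peval q v.
Proof. by rewrite /peval rmorphM. Qed.

Lemma pevalC c (v : 'rV[R]_m) : peval (mpolyC m c) v = c.
Proof. by rewrite /peval mevalC. Qed.

Lemma pevalX i (v : 'rV[R]_m) : peval (mpolyX R (mnm1 i)) v = v 0 i.
Proof. by rewrite /peval mevalXU. Qed.

Lemma pevalB p q v : peval (p - q) v = peval p v - peval q v.
Proof. by rewrite /peval rmorphB. Qed.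

Lemma pevalZ c p v : peval (c *: p) v = c * peval p v.
Proof. by rewrite /peval mevalZ. Qed.

Lemma peval_sum I (s : seq I) (P : pred I) (F : I -> A) v :
  peval (\sum_(i <- s | P i) F i) v = \sum_(i <- s | P i) peval (F i) v.
Proof. by rewrite /peval rmorph_sum. Qed.

Lemma sos_ge0 p v : sos p -> 0 <= peval p v.
Proof.
move=> [s ->]; rewrite peval_sum; apply: sumr_ge0 => q _.
by rewrite expr2 pevalM -expr2 sqr_ge0.
Qed.

Lemma mderivXU (i j : 'I_m) :
  mderiv j (mpolyX R (mnm1 i)) = mpolyC m (i == j)%:R.
Proof.
rewrite mderivX mnm1E -mul_mpolyC; have [->|_] := eqVneq i j.
  rewrite [X in _ * X](_ : _ = 1) ?mulr1// -(mpolyX0 m R).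
  by congr mpolyX; apply/mnmP => k; rewrite mnmBE subnn mnm0E.
by rewrite rmorph0 mul0r.
Qed.

Section Segment.
Variable y : 'rV[R]_m.

Let b i : A := mpolyX R (mnm1 i) - mpolyC m (y 0 i).

(** Substituting y + s (X - y) for the variables X restricts a polynomial to the
    segment from y to the generic point X; the parameter s is the variable of the
    outer polynomial ring. *)
Let segment_morphism : { seg : A -> {poly A} | [/\
  forall c, seg (mpolyC m c) = (mpolyC m c)%:P,
  forall i, seg (mpolyX R (mnm1 i)) = (mpolyC m (y 0 i))%:P + b i *: 'X,
  {morph seg : p q / p + q} & {morph seg : p q / p * q}] }.
Proof.
exists (mmap (polyC \o @mpolyC m R)
             (fun i => (mpolyC m (y 0 i))%:P + b i *: 'X)).
split=> [c|i|p q|p q]; [exact: mmapC| |exact: rmorphD|exact: rmorphM].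
by rewrite mmapX mmap1U.
Qed.

Let seg := sval segment_morphism.

Let segC c : seg (mpolyC m c) = (mpolyC m c)%:P.
Proof. by rewrite /seg; case: segment_morphism => ? []. Qed.

Let segX i : seg (mpolyX R (mnm1 i)) = (mpolyC m (y 0 i))%:P + b i *: 'X.
Proof. by rewrite /seg; case: segment_morphism => ? []. Qed.

Let segD p q : seg (p + q) = seg p + seg q.
Proof. by rewrite /seg; case: segment_morphism => ? []. Qed.

Let segM p q : seg (p * q) = seg p * seg q.
Proof. by rewrite /seg; case: segment_morphism => ? []. Qed.

Let seg_sum I (s : seq I) (F : I -> A) :
  seg (\sum_(i <- s) F i) = \sum_(i <- s) seg (F i).
Proof. by apply: (big_morph seg segD); rewrite -[0](rmorph0 (@mpolyC m R)) segC. Qed.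

Let seg0 p : (seg p).[0] = mpolyC m (peval p y).
Proof.
elim/mpoly_alg_ind: p => [c|i|p q IHp IHq|p q IHp IHq].
- by rewrite segC hornerC pevalC.
- by rewrite segX hornerD hornerC hornerZ hornerX mulr0 addr0 pevalX.
- by rewrite segD hornerD IHp IHq pevalD mpolyCD.
- by rewrite segM hornerM IHp IHq pevalM mpolyCM.
Qed.

Let seg1 p : (seg p).[1] = p.
Proof.
elim/mpoly_alg_ind: p => [c|i|p q IHp IHq|p q IHp IHq].
- by rewrite segC hornerC.
- by rewrite segX hornerD hornerC hornerZ hornerX mulr1 addrC subrK.
- by rewrite segD hornerD IHp IHq.
- by rewrite segM hornerM IHp IHq.
Qed.

Let deriv_seg p : (seg p)^`() = \sum_i (b i)%:P * seg (mderiv i p).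
Proof.
elim/mpoly_alg_ind: p => [c|i|p q IHp IHq|p q IHp IHq].
- rewrite segC derivC big1// => i _.
  by rewrite mderivC -(rmorph0 (@mpolyC m R)) segC rmorph0 mulr0.
- rewrite segX derivD derivC add0r derivZ derivX (bigD1 i)//=.
  rewrite mderivXU eqxx segC rmorph1 mulr1 alg_polyC big1 ?addr0// => j ji.
  by rewrite mderivXU eq_sym (negPf ji) segC !rmorph0 mulr0.
- rewrite segD derivD IHp IHq -big_split; apply: eq_bigr => i _.
  by rewrite mderivD segD mulrDr.
- rewrite segM derivM IHp IHq mulr_suml mulr_sumr -big_split.
  apply: eq_bigr => i _; rewrite mderivM segD !segM /=; ring.
Qed.

(** Along the segment the second derivative of p is the Hessian form at
    direction X - y, a sum of squares because the Hessian factors. *)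
Lemma sos_convex_taylor p : sos_convex p ->
  sos (p - mpolyC m (peval p y) - \sum_i peval (mderiv i p) y *: b i).
Proof.
move=> [s [P hP]].
have := @sos_taylor_remainder (seg p) s
  (fun r => \sum_i (b i)%:P * seg (P r i)).
rewrite seg1 seg0 deriv_seg horner_sum.
have -> : \sum_i ((b i)%:P * seg (mderiv i p)).[0] =
    \sum_i peval (mderiv i p) y *: b i.
  by apply: eq_bigr => i _; rewrite hornerM hornerC seg0 mulrC mul_mpolyC.
apply; rewrite linear_sum/=.
under eq_bigr => i _.
  rewrite derivM derivC mul0r add0r deriv_seg mulr_sumr; over.
have hE i j : mderiv j (mderiv i p) = \sum_r P r j * P r i.
  have /matrixP/(_ j i) := hP; rewrite !mxE => ->.
  by apply: eq_bigr => r _; rewrite mxE.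
under eq_bigr => i _.
  under eq_bigr => j _.
    rewrite hE seg_sum !mulr_sumr; under eq_bigr => r _ do rewrite segM; over.
  rewrite exchange_big; over.
rewrite exchange_big; apply: eq_bigr => r _.
rewrite expr2 mulr_suml; apply: eq_bigr => i _.
rewrite mulr_sumr; apply: eq_bigr => j _.
by rewrite /=; ring.
Qed.

End Segment.
End SumsOfSquares.

(** * Nonnegative SOS-convex polynomials are sums of squares *)

Section SosConvex.
Context {R : realType} {m : nat}.
Implicit Types (p q : mpoly m R) (x y u v : 'rV[R]_m).

Lemma sos_convex_affine p : (forall i j, mderiv i (mderiv j p) = 0) -> sos_convex p.
Proof.
move=> p0; exists 0%N, 0; apply/matrixP => i j.
by rewrite !mxE p0 big_ord0.
Qed.

Lemma sos_convexD p q : sos_convex p -> sos_convex q -> sos_convex (p + q).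
Proof.
move=> [s [P hP]] [t [Q hQ]]; exists (s + t)%N, (col_mx P Q).
rewrite tr_col_mx mul_row_col -hP -hQ; apply/matrixP => i j.
by rewrite !mxE !mderivD.
Qed.

Lemma sos_convexZ c p : 0 <= c -> sos_convex p -> sos_convex (c *: p).
Proof.
move=> c0 [s [P hP]]; exists s, (mpolyC m (Num.sqrt c) *: P).
rewrite [(_ *: P)^T]linearZ/= -scalemxAr -scalemxAl scalerA -rmorphM/=.
rewrite -expr2 sqr_sqrtr//.
rewrite -hP; apply/matrixP => i j.
by rewrite !mxE !mderivZ mul_mpolyC.
Qed.

Lemma sos_convex_sum I (s : seq I) (F : I -> mpoly m R) :
  (forall i, sos_convex (F i)) -> sos_convex (\sum_(i <- s) F i).
Proof.
move=> FP; elim/big_ind: _ => //; last exact: sos_convexD.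
by apply: sos_convex_affine => i j; rewrite !mderiv0.
Qed.

Definition grad p y : 'rV[R]_m := \row_i peval (mderiv i p) y.

Lemma sos_convex_gradient p x y : sos_convex p ->
  peval p y + dot (grad p y) (x - y) <= peval p x.
Proof.
move=> /(@sos_convex_taylor _ _ y) /(@sos_ge0 _ _ _ x).
rewrite !pevalB pevalC peval_sum.
under eq_bigr => i _ do rewrite pevalZ pevalB pevalX pevalC.
suff -> : dot (grad p y) (x - y) =
    \sum_i peval (mderiv i p) y * (x 0 i - y 0 i) by lra.
by apply: eq_bigr => i _; rewrite !mxE.
Qed.

Lemma sos_convex_le p x y a b : sos_convex p -> 0 <= a -> 0 <= b -> a + b = 1 ->
  peval p (a *: x + b *: y) <= a * peval p x + b * peval p y.
Proof.
move=> pc a0 b0 ab; set z := _ + _.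
have /(ler_wpM2l a0) := sos_convex_gradient x z pc.
have /(ler_wpM2l b0) := sos_convex_gradient y z pc.
rewrite !mulrDr -!dotZr.
have : dot (grad p z) (a *: (x - z)) + dot (grad p z) (b *: (y - z)) = 0.
  rewrite -dotDr !scalerBr addrACA -opprD -scalerDl ab scale1r.
  by rewrite subrr dot0r.
have : a * peval p z + b * peval p z = peval p z by rewrite -mulrDl ab mul1r.
lra.
Qed.

Lemma peval_continuous p : continuous (peval p : 'rV[R]_m -> R).
Proof.
elim/(@mpoly_alg_ind R m): p => [c|i|p q IHp IHq|p q IHp IHq].
- rewrite (_ : peval _ = cst c); first exact: cst_continuous.
  by apply/funext => x; rewrite pevalC.
- rewrite (_ : peval _ = fun x : 'rV[R]_m => x 0 i); first exact: coord_continuous.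
  by apply/funext => x; rewrite pevalX.
- rewrite (_ : peval _ = peval p \+ peval q).
    by move=> x; apply: continuousD; [exact: IHp|exact: IHq].
  by apply/funext => x; rewrite pevalD.
- rewrite (_ : peval _ = peval p \* peval q).
    by move=> x; apply: continuousM; [exact: IHp|exact: IHq].
  by apply/funext => x; rewrite pevalM.
Qed.

Lemma peval_line p x u :
  exists P : {poly R}, forall t, P.[t] = peval p (x + t *: u).
Proof.
elim/(@mpoly_alg_ind R m): p => [c|i|p q [P hP] [Q hQ]|p q [P hP] [Q hQ]].
- by exists c%:P => t; rewrite hornerC pevalC.
- exists ((x 0 i)%:P + u 0 i *: 'X) => t.
  by rewrite hornerD hornerC hornerZ hornerX pevalX !mxE mulrC.
- by exists (P + Q) => t; rewrite hornerD hP hQ pevalD.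
- by exists (P * Q) => t; rewrite hornerM hP hQ pevalM.
Qed.

Lemma poly_bounded_ray_const (P : {poly R}) c C :
  (forall t, 0 <= t -> c <= P.[t] <= C) -> forall t, P.[t] = P.[0].
Proof.
move=> Pb t; have [sP|sP] := leqP (size P) 1.
  by rewrite (size1_polyC sP) !hornerC.
have nmax (n : R) : n <= Num.max n 0 by rewrite le_max lexx.
have max0 (n : R) : 0 <= Num.max n 0 by rewrite le_max lexx orbT.
have [lP|lP|/eqP] := ltgtP (lead_coef P) 0.
- have [||n /(_ _ (nmax n))] := @poly_lim_infty _ (- P) (1 - c).
  + by rewrite lead_coefN oppr_gt0.
  + by rewrite size_polyN.
  by rewrite hornerN; have /andP[] := Pb _ (max0 n); lra.
- have [//|//|n /(_ _ (nmax n))] := @poly_lim_infty _ P (C + 1).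
  by have /andP[] := Pb _ (max0 n); lra.
- by rewrite lead_coef_eq0 => /eqP P0; rewrite P0 size_poly0 in sP.
Qed.

(** A direction of recession is a limit of the directions of points of K that
    escape to infinity: K contains the segments from 0 to these points, so being
    closed it contains the limiting ray. *)
Lemma closed_convex_recession (K : set 'rV[R]_m) :
  closed K -> convex K -> K 0 -> ~ bounded_set K ->
  exists2 u, u != 0 & forall t, 0 <= t -> K (t *: u).
Proof.
move=> Kcl Kc K0 Kub.
have Kfar (n : nat) : exists2 z, K z & n%:R < `|z|.
  apply: contrapT => far; apply: Kub; exists n%:R; split; first exact: realn.
  move=> M nM z Kz; apply: ltW; apply: le_lt_trans nM; rewrite leNgt.
  by apply/negP => zn; apply: far; exists z.
pose z n := projT1 (cid2 (Kfar n)).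
have Kz n : K (z n) by rewrite /z; case: cid2.
have zn n : n%:R < `|z n| by rewrite /z; case: cid2.
have z0 n : 0 < `|z n| by apply: le_lt_trans (zn n).
pose w n := `|z n|^-1 *: z n.
pose D := [set v : 'rV[R]_m | `|v| = 1].
have Dc : compact D.
  apply: bounded_closed_compact.
    by exists 1; split=> // M M1 v /= ->; exact: ltW.
  apply: (@preimage_closed _ _ (fun v : 'rV[R]_m => `|v|) [set 1]).
    by move=> v _; exact: norm_continuous.
  exact: closed_eq.
have wD n : D (w n).
  by rewrite /D/= normrZ normfV normr_id mulVf// gt_eqF.
have wF : (w @ \oo) D by exists 0%N => // n _; exact: wD.
have [u [Du wu]] := Dc (w @ \oo) _ wF.
exists u.
  apply/eqP => u0; move: Du; rewrite /D/= u0 normr0 => /esym/eqP.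
  by rewrite oner_eq0.
move=> t t0; pose E := [set v : 'rV[R]_m | K (t *: v)].
have Ecl : closed E.
  apply: (@preimage_closed _ _ (fun v : 'rV[R]_m => t *: v) K) => //.
  by move=> v _; exact: scaler_continuous.
suff : closure E u by rewrite -((closure_id E).1 Ecl).
move: wu; rewrite clusterE; apply.
rewrite /= -/(\forall n \near \oo, E (w n)); near=> n; rewrite /E/=.
have tz : t <= `|z n|.
  apply: ltW; apply: le_lt_trans (zn n); near: n.
  exact: nbhs_infty_ger.
rewrite /w scalerA.
have := @Kc (z n) 0 (t / `|z n|) (1 - t / `|z n|) (Kz n) K0.
rewrite scaler0 addr0; apply; last by rewrite addrC subrK.
  by rewrite divr_ge0.
by rewrite subr_ge0 ler_pdivrMr// mul1r.
Unshelve. all: by end_near.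
Qed.

(** A polynomial bounded on a ray is constant, so p is constant on the line
    through 0; at x + t u convexity bounds it by its values at 2 x and 2 t u, so it
    is constant on the parallel lines as well. *)
Lemma sos_convex_const_line p c u : sos_convex p -> (forall x, c <= peval p x) ->
  (forall t, 0 <= t -> peval p (t *: u) <= peval p 0) ->
  forall x t, peval p (x + t *: u) = peval p x.
Proof.
move=> pc pb pu.
have line0 t : peval p (t *: u) = peval p 0.
  have [P hP] := peval_line p 0 u.
  have PC s : 0 <= s -> c <= P.[s] <= peval p 0.
    by move=> s0; rewrite hP pb add0r pu.
  by have := poly_bounded_ray_const PC t; rewrite !hP scale0r addr0 add0r.
move=> x t; have [P hP] := peval_line p x u.
have PC s : 0 <= s -> c <= P.[s] <= 2^-1 * peval p (2 *: x) + 2^-1 * peval p 0.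
  move=> _; rewrite hP pb/= -(line0 (2 * s)).
  have := @sos_convex_le p (2 *: x) ((2 * s) *: u) 2^-1 2^-1 pc.
  rewrite !scalerA mulrA mulVf ?pnatr_eq0// mul1r scale1r; apply.
  - by rewrite invr_ge0.
  - by rewrite invr_ge0.
  - by field.
by have := poly_bounded_ray_const PC t; rewrite !hP scale0r addr0.
Qed.

Lemma closed_sublevel (S : {set 'I_m}) p c :
  closed [set x : 'rV[R]_m | (forall i, i \notin S -> x 0 i = 0) /\ peval p x <= c].
Proof.
rewrite (_ : [set _ | _] =
  (\bigcap_(i in [set i | i \notin S]) [set x : 'rV[R]_m | x 0 i = 0]) `&`
  [set x | peval p x <= c]); last by apply/seteqP; split.
apply: closedI.
  apply: closed_bigI => i _.
  apply: (@preimage_closed _ _ (fun x : 'rV[R]_m => x 0 i) [set 0]).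
    by move=> v _; exact: coord_continuous.
  exact: closed_eq.
apply: (@preimage_closed _ _ (peval p) [set t | t <= c]).
  by move=> v _; exact: peval_continuous.
exact: closed_le.
Qed.

(** An SOS-convex polynomial that is bounded below attains its infimum, although
    its sublevel sets may be unbounded: an unbounded one has a recession
    direction u, along which p is constant, and then a coordinate i with u_i <> 0
    can be set to 0 without changing the values of p.  The induction is on the
    set S of the coordinates that are left. *)
Lemma sos_convex_attains p c : sos_convex p -> (forall x, c <= peval p x) ->
  exists y, forall x, peval p y <= peval p x.
Proof.
move=> pc pb.
suff H n (S : {set 'I_m}) : (#|S| <= n)%N ->
    (forall x, exists2 y : 'rV[R]_m, forall i, i \notin S -> y 0 i = 0 &
      peval p y <= peval p x) ->
    exists y, forall x, peval p y <= peval p x.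
  by apply: (H _ [set: 'I_m]%SET (leqnn _)) => x; exists x => // i; rewrite inE.
elim: n S => [|n IHn] S.
  rewrite leqn0 cards_eq0 => /eqP -> Sp; exists 0 => x.
  have [y y0 yx] := Sp x; suff <- : y = 0 by [].
  by apply/rowP => i; rewrite y0 ?inE// mxE.
move=> Sn Sp.
pose K := [set x : 'rV[R]_m |
  (forall i, i \notin S -> x 0 i = 0) /\ peval p x <= peval p 0].
have K0 : K 0 by split=> // i _; rewrite mxE.
have Kcl : closed K by exact: closed_sublevel.
have [Kb|Kub] := pselect (bounded_set K).
  have [||y /set_mem Ky yK] :=
    @compact_EVT_min _ R (peval p) K _ (bounded_closed_compact Kb Kcl).
  - by exists 0.
  - exact/continuous_subspaceT/peval_continuous.
  exists y => x; have [z zS zx] := Sp x; apply: le_trans zx.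
  have [z0|z0] := leP (peval p z) (peval p 0).
    by apply: yK; exact/mem_set.
  by apply: le_trans (ltW z0); exact: Ky.2.
have Kc : convex K.
  move=> x y a b [xS x0] [yS y0] a0 b0 ab; split.
    by move=> i iS; rewrite !mxE xS// yS// !mulr0 addr0.
  apply: le_trans (sos_convex_le x y pc a0 b0 ab) _.
  rewrite -[leRHS]mul1r -ab mulrDl.
  by apply: lerD; exact: ler_wpM2l.
have [u u0 uK] := closed_convex_recession Kcl Kc K0 Kub.
have pu := sos_convex_const_line pc pb (fun t t0 => (uK t t0).2).
have [i ui] := rV0Pn _ u0.
have iS : i \in S.
  apply: contraNT ui => iS; have := (uK 1 ler01).1 i iS.
  by rewrite scale1r => ->.
apply: (IHn (S :\ i)%SET).
  by rewrite (cardsD1 i S) iS in Sn.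
move=> x; have [y yS yx] := Sp x; exists (y - (y 0 i / u 0 i) *: u).
  move=> j; rewrite !inE negb_and negbK !mxE => /orP[/eqP->|jS].
    by rewrite divfK// subrr.
  have := (uK 1 ler01).1 j jS; rewrite scale1r => uj.
  by rewrite uj (yS _ jS) mulr0 subrr.
by rewrite -scaleNr pu.
Qed.

(** Evaluating the gradient inequality at y from the point y + t e_i shows that the
    i-th derivative there has the sign of t, so it vanishes at y by
    continuity. *)
Lemma sos_convex_grad_min p y : sos_convex p ->
  (forall x, peval p y <= peval p x) -> grad p y = 0.
Proof.
move=> pc ymin; apply/rowP => i; rewrite !mxE; apply/eqP.
pose f t := peval (mderiv i p) (y + t *: delta_mx 0 i).
have fc : {for 0, continuous f}.
  apply: continuous_comp; last exact: peval_continuous.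
  apply: continuousD; first exact: cst_continuous.
  exact: scalel_continuous.
have f0 : f 0 = peval (mderiv i p) y by rewrite /f scale0r addr0.
have fs t : 0 <= t * f t.
  have := sos_convex_gradient y (y + t *: delta_mx 0 i) pc.
  rewrite opprD addrA subrr add0r dotNr dotZr dot_delta mxE -/(f t).
  have := ymin (y + t *: delta_mx 0 i); lra.
have half_in e : 0 < e -> ball (0 : R) e (e / 2) /\ ball (0 : R) e (- (e / 2)).
  by move=> e0; rewrite /ball/= !sub0r opprK normrN gtr0_norm; lra.
rewrite -f0 eq_le; apply/andP; split; rewrite leNgt; apply/negP => f0s.
  have /nbhs_ballP[e /= e0 eP] : \forall t \near 0, 0 < f t by exact: (cvgr_gt _ fc).
  have := fs (- (e / 2)); rewrite mulNr oppr_ge0 leNgt mulr_gt0 ?divr_gt0//.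
  exact/eP/(half_in e e0).2.
have /nbhs_ballP[e /= e0 eP] : \forall t \near 0, f t < 0 by exact: (cvgr_lt _ fc).
have := fs (e / 2); rewrite pmulr_rge0 ?divr_gt0// leNgt.
by rewrite eP//; exact: (half_in e e0).1.
Qed.

(** Helton and Nie: at a minimizer y the Taylor expansion has no linear term, so p
    is p y plus a sum of squares. *)
Lemma sos_convex_nonneg_sos p : sos_convex p -> (forall x, 0 <= peval p x) -> sos p.
Proof.
move=> pc p0; have [y ymin] := sos_convex_attains pc p0.
have := sos_convex_taylor y pc; rewrite big1 => [|i _]; last first.
  have /rowP/(_ i) := sos_convex_grad_min pc ymin; rewrite !mxE => ->.
  by rewrite scale0r.
rewrite subr0 => /sosD /(_ (sosC (p0 y))).
by rewrite subrK.
Qed.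

End SosConvex.

(** * Multipliers for convex inequalities over a projected spectrahedron *)

Section ConicMultipliers.
Context {R : realType} {m N nu L : nat}.
Variables (F0 : 'M[R]_nu) (F : 'I_m -> 'M[R]_nu) (M : 'I_N -> 'M[R]_nu).
Hypotheses (F0_sym : F0 \is symmetricmx)
  (F_sym : forall i, F i \is symmetricmx) (M_sym : forall t, M t \is symmetricmx).

Lemma lmi_sym v xi : lmi F0 F M v xi \is symmetricmx.
Proof.
have tr A : A \is symmetricmx -> A^T = A :> 'M[R]_nu.
  by rewrite symmx_tr => /eqP.
rewrite symmx_tr /lmi !linearD !linear_sum/= (tr F0)//.
apply/eqP; congr (_ + _ + _); apply: eq_bigr => i _; rewrite linearZ/= tr//.
Qed.

Lemma lmi_comb v v' xi xi' a b : a + b = 1 ->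
  lmi F0 F M (a *: v + b *: v') (a *: xi + b *: xi') =
  a *: lmi F0 F M v xi + b *: lmi F0 F M v' xi'.
Proof.
move=> ab; rewrite /lmi !scalerDr !scaler_sumr.
rewrite [RHS]addrACA [X in _ = X + _]addrACA -scalerDl ab scale1r -!big_split/=.
congr (_ + _ + _); apply: eq_bigr => i _;
  by rewrite !mxE scalerDl !scalerA.
Qed.

Lemma lmi_xi0 v : lmi F0 F M v 0 = F0 + \sum_i v 0 i *: F i.
Proof.
by rewrite /lmi [X in _ + _ + X]big1 ?addr0// => t _; rewrite mxE scale0r.
Qed.

Lemma lmi_delta v t s :
  lmi F0 F M v (s *: delta_mx 0 t) = lmi F0 F M v 0 + s *: M t.
Proof.
rewrite lmi_xi0 /lmi; congr (_ + _).
rewrite (bigD1 t)//= !mxE !eqxx mulr1 big1 ?addr0// => i it.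
by rewrite !mxE (negPf it) andbF mulr0 scale0r.
Qed.

Lemma trace_lmi (Z : 'M[R]_nu) v xi :
  \tr (Z *m lmi F0 F M v xi) = \tr (Z *m F0) + \sum_i v 0 i * \tr (Z *m F i) +
    \sum_t xi 0 t * \tr (Z *m M t).
Proof.
rewrite /lmi !mulmxDr !mulmx_sumr !linearD !linear_sum.
by congr (_ + _ + _); apply: eq_bigr => i _; rewrite -scalemxAr linearZ.
Qed.

Lemma trace_lmi0 (Z : 'M[R]_nu) v :
  \tr (Z *m lmi F0 F M v 0) = \tr (Z *m F0) + \sum_i v 0 i * \tr (Z *m F i).
Proof.
rewrite trace_lmi [X in _ + X]big1 ?addr0// => t _; by rewrite mxE mul0r.
Qed.

Lemma dot_mxvec (A B : 'M[R]_nu) : dot (mxvec A) (mxvec B) = \tr (A^T *m B).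
Proof.
rewrite /dot (reindex _ (curry_mxvec_bij _ _))/=.
rewrite (eq_bigr (fun ij => A ij.1 ij.2 * B ij.1 ij.2)) => [|[i j] _]; last first.
  by rewrite /= !mxvecE.
rewrite -(pair_bigA _ (fun i j => A i j * B i j))/= exchange_big.
apply: eq_bigr => j _; rewrite mxE; apply: eq_bigr => i _.
by rewrite mxE.
Qed.

Lemma trace_mul_delta (Z : 'M[R]_nu) i j : \tr (Z *m delta_mx i j) = Z j i.
Proof.
rewrite /mxtrace (bigD1 j)//= big1 => [|k kj].
  rewrite addr0 mxE (bigD1 i)//= mxE !eqxx mulr1 big1 ?addr0// => k ki.
  by rewrite mxE (negPf ki) mulr0.
by rewrite mxE big1// => l _; rewrite mxE (negPf kj) andbF mulr0.
Qed.

Lemma quad_delta (x : 'cV[R]_nu) i j :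
  (x^T *m delta_mx i j *m x) 0 0 = x i 0 * x j 0.
Proof.
rewrite -[LHS]trace_mx11 mxtrace_mulC mulmxA trace_mul_delta mxE big_ord1 mxE.
by rewrite mulrC.
Qed.

(** The hypothesis quantifies over matrices with a nonnegative form that need not
    be symmetric; the differences of elementary matrices E_ij - E_ji among them
    force Z to be symmetric. *)
Lemma psd_of_trace_ge0 (Z : 'M[R]_nu) :
  (forall P : 'M[R]_nu, (forall x : 'cV_nu, 0 <= (x^T *m P *m x) 0 0) ->
     0 <= \tr (Z *m P)) -> psd Z.
Proof.
move=> ZP; split=> [|x].
  have Zle i j : Z j i <= Z i j.
    rewrite -subr_ge0 -!trace_mul_delta -linearB -mulmxBr; apply: ZP => x.
    rewrite mulmxBr mulmxBl [X in 0 <= X]mxE [X in _ + X]mxE !quad_delta.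
    by rewrite [x i 0 * _]mulrC subrr.
  rewrite symmx_tr; apply/eqP/matrixP => i j; rewrite mxE.
  by apply/eqP; rewrite eq_le !Zle.
have := ZP (x *m x^T) (rank1_psd x).2.
by rewrite mulmxA mxtrace_mulC mulmxA trace_mx11.
Qed.

(** The convex set C of the pairs (y, W), encoded as row vectors, such that for
    some v and xi one has phi l v < y_l for all l and W is below lmi v xi, misses
    the origin: (0, 0) in C would give a point of Omega where every phi l is
    negative.  Write a functional that is nonnegative on C as
    delta y - tr (Z W).  That C is upward closed in y and downward closed in W
    gives delta >= 0 and Z psd, that xi is free gives tr (Z M_t) = 0, and the
    Slater point excludes delta = 0, so delta can be normalized. *)
Lemma conic_multipliers (phi : 'I_L.+1 -> mpoly m R) :
  (forall l, sos_convex (phi l)) -> slater F0 F M ->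
  (forall v, Omega F0 F M v -> exists l, 0 <= peval (phi l) v) ->
  exists (delta : 'rV[R]_L.+1) (Z : 'M[R]_nu),
    [/\ simplex L.+1 delta, psd Z, forall t, \tr (Z *m M t) = 0 &
      forall v, 0 <= \sum_l delta 0 l * peval (phi l) v
        - (\tr (Z *m F0) + \sum_i v 0 i * \tr (Z *m F i))].
Proof.
move=> phic [vs [xis vspd]] phiO.
pose C := [set z : 'rV[R]_(L.+1 + nu * nu) | exists v xi,
  (forall l, peval (phi l) v < lsubmx z 0 l) /\
  forall x : 'cV_nu, 0 <= (x^T *m (lmi F0 F M v xi - vec_mx (rsubmx z)) *m x) 0 0].
have Cc : convex C.
  move=> z z' a b [v [xi [zv zq]]] [v' [xi' [zv' zq']]] a0 b0 ab.
  exists (a *: v + b *: v'), (a *: xi + b *: xi'); split=> [l|x].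
    apply: le_lt_trans (sos_convex_le v v' (phic l) a0 b0 ab) _.
    have -> : lsubmx (a *: z + b *: z') 0 l = a * lsubmx z 0 l + b * lsubmx z' 0 l.
      by rewrite !mxE.
    exact: lt_comb.
  have -> : vec_mx (rsubmx (a *: z + b *: z')) =
      a *: vec_mx (rsubmx z) + b *: vec_mx (rsubmx z') :> 'M[R]_nu.
    by rewrite linearD !linearZ/= linearD !linearZ.
  rewrite lmi_comb// opprD addrACA -!scalerBr mulmxDr mulmxDl.
  rewrite -!scalemxAr -!scalemxAl mxE.
  by apply: addr_ge0; rewrite mxE mulr_ge0.
have C0 : ~ C 0.
  move=> [v [xi [v0 vq]]].
  have [|l] := phiO v.
    exists xi; split; first exact: lmi_sym.
    by move=> x; have := vq x; rewrite linear0 linear0 subr0.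
  by have := v0 l; rewrite linear0 mxE leNgt => ->.
have [z z0 zC] := separation Cc C0.
pose d : 'rV[R]_L.+1 := lsubmx (z : 'rV_(L.+1 + nu * nu)).
pose Z : 'M[R]_nu := - (vec_mx (rsubmx (z : 'rV_(L.+1 + nu * nu))))^T.
have zE : z = row_mx d (mxvec (- Z^T)).
  rewrite (_ : - Z^T = vec_mx (rsubmx (z : 'rV_(L.+1 + nu * nu)))).
    by rewrite vec_mxK hsubmxK.
  by rewrite /Z [(- _)^T]linearN/= trmxK opprK.
have key v xi (P : 'M[R]_nu) (y : 'rV[R]_L.+1) :
    (forall x : 'cV_nu, 0 <= (x^T *m P *m x) 0 0) ->
    (forall l, peval (phi l) v < y 0 l) ->
    0 <= dot d y - \tr (Z *m lmi F0 F M v xi) + \tr (Z *m P).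
  move=> Pq yl; have := zC (row_mx y (mxvec (lmi F0 F M v xi - P))).
  rewrite zE (@dot_row_mx R L.+1) dot_mxvec [(- _)^T]linearN/= trmxK.
  rewrite mulNmx mulmxBr opprB [\tr (_ - _)]linearB/= addrA addrAC; apply.
  exists v, xi; split=> [l|x]; first by rewrite row_mxKl.
  by rewrite row_mxKr mxvecK subKr.
pose y0 v : 'rV[R]_L.+1 := \row_l (peval (phi l) v + 1).
have y0l v l : peval (phi l) v < y0 v 0 l by rewrite mxE; lra.
have q0 (x : 'cV[R]_nu) : 0 <= (x^T *m 0 *m x) 0 0 by rewrite mulmx0 mul0mx mxE.
pose c0 := dot d (y0 0) - \tr (Z *m lmi F0 F M 0 0).
have d_ge0 l : 0 <= d 0 l.
  apply: (@ray_ge0 _ c0) => s s0.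
  have := @key 0 0 0 (y0 0 + s *: delta_mx 0 l) q0.
  rewrite mulmx0 linear0 addr0 dotDr dotZr dot_delta addrAC; apply=> k.
  rewrite [ltRHS]mxE; apply: ltr_wpDr; last exact: y0l.
  by rewrite !mxE mulr_ge0.
have Zpsd : psd Z.
  apply: psd_of_trace_ge0 => P Pq.
  apply: (@ray_ge0 _ c0) => s s0.
  have := @key 0 0 (s *: P) (y0 0).
  rewrite -scalemxAr linearZ/=; apply; last exact: y0l.
  by move=> x; rewrite -scalemxAr -scalemxAl mxE mulr_ge0.
have ZM t : \tr (Z *m M t) = 0.
  have key' s : 0 <= c0 - s * \tr (Z *m M t).
    have := @key 0 (s *: delta_mx 0 t) 0 _ q0 (y0l 0).
    rewrite mulmx0 linear0 addr0 lmi_delta mulmxDr linearD/=.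
    by rewrite -scalemxAr linearZ/= opprD addrA.
  apply: oppr_inj; rewrite oppr0; apply: (@line_eq0 _ c0) => s.
  by rewrite mulrN; exact: key'.
have d0 : 0 < \sum_l d 0 l.
  rewrite lt_def sumr_ge0// andbT; apply: contra z0 => /eqP ds.
  have {}ds : d = 0.
    apply/rowP => l; rewrite [RHS]mxE; apply/eqP; rewrite eq_le d_ge0 andbT -ds.
    by rewrite (bigD1 l)//= lerDl sumr_ge0.
  suff Z0 : Z = 0 by rewrite zE ds Z0 !linear0 row_mx0.
  apply: psd_trace_le0_eq0 Zpsd vspd _.
  have := key vs xis 0 _ q0 (y0l vs).
  by rewrite ds dot0l mulmx0 linear0 addr0 add0r oppr_ge0.
have dphi v : 0 <= \sum_l d 0 l * peval (phi l) v - \tr (Z *m lmi F0 F M v 0).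
  apply/ler_addgt0Pr => e e0; set S := \sum_l d 0 l in d0.
  have := key v 0 0 (\row_l (peval (phi l) v + e / S)) q0.
  rewrite mulmx0 linear0 addr0 /dot.
  under eq_bigr => l _ do rewrite [X in _ * X]mxE mulrDr.
  rewrite big_split/= -mulr_suml [S * _]mulrC divfK ?gt_eqF// addrAC; apply=> l.
  by rewrite mxE ltrDl divr_gt0.
set S := \sum_l d 0 l in d0.
exists (S^-1 *: d), (S^-1 *: Z); split.
- split=> [l|]; first by rewrite mxE mulr_ge0 ?invr_ge0 ?(ltW d0).
  by under eq_bigr => l _ do rewrite mxE; rewrite -mulr_sumr mulVf// gt_eqF.
- have [Zs Zq] := Zpsd; split=> [|x].
    by move: Zs; rewrite !symmx_tr linearZ/= => /eqP ->.
  by rewrite -scalemxAr -scalemxAl mxE mulr_ge0 ?invr_ge0 ?(ltW d0).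
- by move=> t; rewrite -scalemxAl linearZ/= ZM mulr0.
- move=> v; rewrite -trace_lmi0 -scalemxAl linearZ/=.
  under eq_bigr => l _ do rewrite mxE -mulrA.
  by rewrite -mulr_sumr -mulrBr mulr_ge0 ?invr_ge0 ?(ltW d0).
Qed.

End ConicMultipliers.

(** * Integration against nonnegative charges; atomic measures *)

Lemma continuous_sumr {R : realType} {T : topologicalType} I (s : seq I)
    (f : I -> T -> R) :
  (forall j, continuous (f j)) -> continuous (fun v => \sum_(j <- s) f j v).
Proof.
by move=> fc v; apply: cvg_big => [|j _]; [exact: add_continuous|exact: fc].
Qed.

Lemma continuous_maxI {R : realType} {T : topologicalType} n
    (f : 'I_n.+1 -> T -> R) :
  (forall j, continuous (f j)) -> continuous (fun v => maxI (f ^~ v)).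
Proof.
move=> fc; rewrite /maxI; elim: (index_enum _) => [|i s IHs].
  by under eq_fun do rewrite big_nil; exact: fc.
under eq_fun do rewrite big_cons.
by move=> v; apply: (@continuous_max R T); [exact: fc|exact: IHs].
Qed.

Lemma continuous_minI {R : realType} {T : topologicalType} n
    (f : 'I_n.+1 -> T -> R) :
  (forall j, continuous (f j)) -> continuous (fun v => minI (f ^~ v)).
Proof.
move=> fc; rewrite /minI; elim: (index_enum _) => [|i s IHs].
  by under eq_fun do rewrite big_nil; exact: fc.
under eq_fun do rewrite big_cons.
by move=> v; apply: (@continuous_min R T); [exact: fc|exact: IHs].
Qed.

Section NonnegMeasures.
Context {R : realType} {T : topologicalType} {A : set T} (A0 : A !=set0).
Hypotheses (Ac : compact A) (T2 : hausdorff_space T).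
Local Notation X := (borel_subset A0).
Implicit Types (mu : {charge set X -> \bar R}) (f : T -> R).

Definition inclusion (x : X) : T := set_val (x : set_type A).

Lemma inclusionP x : A (inclusion x).
Proof. exact: set_valP. Qed.

Lemma inclusion_continuous : continuous (set_val : set_type A -> T).
Proof. exact: initial_continuous. Qed.

Lemma open_borel (U : set (set_type A)) : open U -> measurable (U : set X).
Proof. by move=> Uo; apply: sub_sigma_algebra. Qed.

Lemma measurable_restriction f : continuous f ->
  measurable_fun [set: X] (f \o inclusion).
Proof.
move=> fc; apply: (measurability _ (RGenOInfty.measurableE R)).
move=> /= _ [_ [a ->]] <-; rewrite setTI; apply: open_borel.
apply: (@open_comp _ _ (f \o set_val) `]a, +oo[%classic).
  move=> x _; apply: continuous_comp; last exact: fc.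
  exact: inclusion_continuous.
exact: itv_open_ends_open.
Qed.

Lemma bounded_restriction f : continuous f ->
  exists C, forall x : X, `|f (inclusion x)| <= C.
Proof.
move=> fc.
have /compact_bounded[C [_ fC]] : compact (f @` A).
  by apply: continuous_compact => //; exact: continuous_subspaceT.
exists (C + 1) => x; apply: fC; first by rewrite ltrDl.
by exists (inclusion x) => //; exact: inclusionP.
Qed.

Lemma jordan_neg_nonneg mu (B : set X) : cnonneg mu -> measurable B ->
  jordan_neg (hahnP mu) B = 0%E.
Proof.
move=> mu0 mB; have [_ [mN Nneg] _ _] := hahnP mu.
rewrite jordan_negE cjordan_negE /crestr0 mem_set// /crestr.
suff -> : mu (B `&` hahn_neg mu) = 0%E by rewrite oppe0.
apply/eqP; rewrite eq_le mu0 ?andbT; last exact: measurableI.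
by apply: Nneg; [exact: measurableI|exact: subIsetr].
Qed.

Lemma jordan_pos_nonneg mu (B : set X) : cnonneg mu -> measurable B ->
  jordan_pos (hahnP mu) B = mu B.
Proof.
move=> mu0 mB; rewrite [RHS](jordan_decomp (hahnP mu) mB) /cadd/=.
by rewrite cscaleN1 [X in (_ - X)%E](jordan_neg_nonneg mu0 mB) oppe0 adde0.
Qed.

Lemma tvarE mu (B : set X) : cnonneg mu -> measurable B -> tvar mu B = mu B.
Proof.
move=> mu0 mB.
by rewrite /tvar /charge_variation /= jordan_neg_nonneg// adde0 jordan_pos_nonneg.
Qed.

Lemma integral_onE mu f : cnonneg mu ->
  integral_on mu f = Rintegral (jordan_pos (hahnP mu)) setT (f \o inclusion).
Proof.
move=> mu0; rewrite /integral_on /cintegral.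
rewrite [X in _ - X](_ : _ = 0) ?subr0// /Rintegral.
rewrite (eq_measure_integral mzero) ?integral_measure_zero// => B mB _.
exact: jordan_neg_nonneg.
Qed.

Lemma integrable_restriction mu f : continuous f ->
  (jordan_pos (hahnP mu)).-integrable setT (EFin \o (f \o inclusion)).
Proof.
move=> fc; apply: measurable_bounded_integrable => //.
- by rewrite ltey_eq fin_num_measure.
- exact: measurable_restriction.
- have [C fC] := bounded_restriction fc.
  exists C; split; first exact: num_real.
  by move=> M CM x _; apply: le_trans (fC x) (ltW CM).
Qed.

Lemma integral_onD mu f f' : cnonneg mu -> continuous f -> continuous f' ->
  integral_on mu (fun v => f v + f' v) = integral_on mu f + integral_on mu f'.
Proof.
move=> mu0 fc fc'; rewrite !integral_onE// -RintegralD//;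
  exact: integrable_restriction.
Qed.

Lemma integral_onZ mu f c : cnonneg mu -> continuous f ->
  integral_on mu (fun v => c * f v) = c * integral_on mu f.
Proof.
move=> mu0 fc; rewrite !integral_onE// -RintegralZl//.
exact: integrable_restriction.
Qed.

Lemma integral_on_ge0 mu f : cnonneg mu -> (forall v, A v -> 0 <= f v) ->
  0 <= integral_on mu f.
Proof.
move=> mu0 f0; rewrite integral_onE//; apply: Rintegral_ge0 => x _.
exact/f0/inclusionP.
Qed.

Lemma integral_on_sum mu n (lam : 'I_n -> R) (f : 'I_n -> T -> R) :
  cnonneg mu -> (forall j, continuous (f j)) ->
  integral_on mu (fun v => \sum_j lam j * f j v) =
  \sum_j lam j * integral_on mu (f j).
Proof.
move=> mu0; elim: n lam f => [|n IHn] lam f fc.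
  rewrite big_ord0 (_ : (fun _ => _) = (fun v => 0 * cst 0 v)); last first.
    by apply/funext => v; rewrite big_ord0 mul0r.
  by rewrite integral_onZ ?mul0r//; exact: cst_continuous.
under eq_fun => v do rewrite big_ord_recl.
have cZ (c : R) g : continuous g -> continuous (fun v : T => c * g v).
  by move=> gc v; apply: continuousM; [exact: cst_continuous|exact: gc].
rewrite integral_onD//; last 2 first.
- exact: cZ.
- by apply: continuous_sumr => j; exact: cZ.
by rewrite integral_onZ// IHn// big_ord_recl.
Qed.

Definition atomic_integral (s : seq ({nonneg R} * X)) f : R :=
  \sum_(p <- s) p.1%:num * f (inclusion p.2).

Lemma finite_closed_subtype (W : set (set_type A)) : finite_set W -> closed W.
Proof.
move=> Wfin; rewrite (_ : W = set_val @^-1` (set_val @` W)).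
  apply: preimage_closed; first by move=> x _; exact: inclusion_continuous.
  have /accessible_finite_set_closed := hausdorff_accessible T2.
  by apply; exact: finite_image.
apply/seteqP; split=> [x Wx|x [y Wy /val_inj <-]//]; by exists x.
Qed.

(** Finite sums of weighted point masses are regular: removing from the whole
    space the atoms outside B leaves an open set of the same mass as B, and the
    atoms inside B form a compact set of that mass. *)
Lemma atomic_measure (s : seq ({nonneg R} * X)) :
  exists2 mu : {charge set X -> \bar R}, nonneg_measures mu &
    forall f, continuous f -> integral_on mu f = atomic_integral s f.
Proof.
pose x0 : {nonneg R} * X := (@NngNum R 0 (lexx _), point).
pose m_ i : {measure set X -> \bar R} :=
  mscale (nth x0 s i).1 (dirac (nth x0 s i).2).
have nuE B : msum m_ (size s) B = (\sum_(p <- s) p.1%:num * \1_B p.2)%:E.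
  rewrite /msum (big_nth x0) big_mkord -sumEFin.
  by apply: eq_bigr => i _; rewrite /m_/= /mscale/= diracE indicE EFinM.
have [mu muE] : exists mu : {charge set X -> \bar R},
    forall B, mu B = msum m_ (size s) B.
  have nufin : fin_num_fun (msum m_ (size s)) by move=> B _; rewrite nuE.
  pose nuf : {finite_measure set X -> \bar R} :=
    HB.pack (msum m_ (size s)) (Measure_isFinite.Build _ _ _ _ nufin).
  by exists (charge_of_finite_measure nuf).
have mu0 : cnonneg mu by move=> B mB; rewrite muE measure_ge0.
have jnu (f : X -> R) : Rintegral (jordan_pos (hahnP mu)) setT f =
    Rintegral (msum m_ (size s)) setT f.
  congr fine; apply: eq_measure_integral => B mB _.
  by rewrite [LHS](jordan_pos_nonneg mu0 mB) muE.
have Ige0 f : continuous f -> (forall x, A x -> 0 <= f x) ->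
    integral_on mu f = atomic_integral s f.
  move=> fc f0; rewrite integral_onE// jnu /Rintegral.
  have mf : measurable_fun setT (EFin \o (f \o inclusion)).
    by apply/measurable_EFinP; exact: measurable_restriction fc.
  rewrite ge0_integral_measure_sum//; last first.
    by move=> x _; rewrite lee_fin; exact/f0/inclusionP.
  under eq_bigr => i _.
    rewrite ge0_integral_mscale//; last first.
      by move=> x _; rewrite lee_fin; exact/f0/inclusionP.
    rewrite integral_dirac// diracT mul1e -EFinM; over.
  by rewrite sumEFin /= /atomic_integral (big_nth x0) big_mkord.
exists mu; last first.
  move=> f fc; have [C fC] := bounded_restriction fc.
  have cC (c : R) : continuous ((fun=> c) : T -> R) by exact: cst_continuous.
  have fC0 v : A v -> 0 <= f v + C.
    move=> Av; have := fC (SigSub (mem_set Av) : set_type A).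
    by rewrite ler_norml /inclusion /= => /andP[+ _]; lra.
  have C0 : 0 <= C.
    by apply: le_trans (normr_ge0 _) (fC point).
  have fCc : continuous (fun v => f v + C).
    by move=> v; apply: continuousD; [exact: fc|exact: cC].
  (* The sums of integrals need f >= 0, hence the shift by a bound C. *)
  have := Ige0 _ fCc fC0; rewrite integral_onD// (Ige0 (fun=> C))//.
  rewrite /atomic_integral; under [RHS]eq_bigr do rewrite mulrDr.
  by rewrite big_split => /addIr.
split=> // B mB.
have WF : finite_set [set x : X | x \in map snd s] by exact: finite_seq.
have nuS B1 B2 : measurable B1 -> measurable B2 -> B1 `<=` B2 -> (mu B1 <= mu B2)%E.
  by move=> m1 m2 B12; rewrite !muE le_measure// inE.
have mfin (W : set X) : finite_set W -> measurable W.
  move=> Wf; rewrite -(setCK W); apply: measurableC; apply: open_borel.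
  by rewrite openC; exact: finite_closed_subtype.
have nu_eq (B1 B2 : set X) :
    (forall x, x \in map snd s -> B1 x <-> B2 x) -> mu B1 = mu B2.
  move=> B12; rewrite !muE !nuE; congr EFin.
  apply: eq_big_seq => p ps; congr (_ * _); rewrite !indicE.
  have /B12 pB : p.2 \in map snd s by exact: map_f.
  suff -> : (p.2 \in B1) = (p.2 \in B2) by [].
  by apply/idP/idP; rewrite !inE => /pB.
rewrite tvarE//; split; apply/eqP; rewrite eq_le; apply/andP; split.
- apply/ereal_infP => _ [U [Uo BU] <-].
  by rewrite tvarE//; [apply: nuS => //|]; exact: open_borel.
- pose U : set X := ~` [set x | x \in map snd s /\ ~ B x].
  have Uo : open (U : set (set_type A)).
    rewrite openC; apply: finite_closed_subtype.
    by apply: sub_finite_set WF => x [].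
  apply: ereal_inf_lbound; exists U.
    by split=> // x Bx [_].
  rewrite tvarE//; last exact: open_borel.
  apply: nu_eq => x xs; rewrite /U/=; split=> [|Bx [_ //]].
  by move=> /not_andP[|/contrapT].
- pose K : set X := [set x | x \in map snd s] `&` B.
  have Kf : finite_set K by apply: sub_finite_set WF => x [].
  apply: ereal_sup_ubound; exists K.
    split; last by move=> x [].
    exact: finite_compact.
  rewrite tvarE//; last exact: mfin.
  by apply: nu_eq => x xs; split=> [[]|].
- apply: ge_ereal_sup => _ [K [Kc KB] <-].
  have mK : measurable (K : set X).
    rewrite -(setCK K); apply: measurableC; apply: open_borel.
    rewrite openC (_ : K = set_val @^-1` (set_val @` K)); last first.
      by apply/seteqP; split=> [x Kx|x [y Ky /val_inj <-]//]; exists x.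
    apply: preimage_closed; first by move=> x _; exact: inclusion_continuous.
    apply: compact_closed => //; apply: continuous_compact => //.
    by apply: continuous_subspaceT; exact: inclusion_continuous.
  by rewrite tvarE//; exact: nuS.
Qed.

End NonnegMeasures.

(** * Lagrange multipliers of the moment constraints *)

Section MomentMultipliers.
Context {R : realType} {m J : nat} {A : set 'rV[R]_m} (A0 : A !=set0).
Hypothesis (Ac : compact A).
Local Notation X := (borel_subset A0).
Variables (G : 'rV[R]_m -> R) (h : 'I_J -> mpoly m R) (gamma : 'rV[R]_J) (c : R).
Hypothesis Gc : continuous G.

Let ai := @atomic_integral R _ A A0.

Let scaleA (a : {nonneg R}) (s : seq ({nonneg R} * X)) :=
  [seq ((a%:num * p.1%:num)%:nng, p.2) | p <- s].

Let ai_comb a b s s' f :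
  ai (scaleA a s ++ scaleA b s') f = a%:num * ai s f + b%:num * ai s' f.
Proof.
rewrite /ai /atomic_integral big_cat !big_map !mulr_sumr.
by congr (_ + _); apply: eq_bigr => p _; rewrite mulrA.
Qed.

Let dirac_ai v : A v -> exists x : X, inclusion x = v.
Proof. by move=> Av; exists (SigSub (mem_set Av) : set_type A). Qed.

Lemma moment_cone_ge0 (lam : 'rV[R]_J) lam0 x :
  orthant J lam ->
  (forall v, A v -> 0 <= \sum_j lam 0 j * peval (h j) v + lam0) ->
  moment_cone A0 h x -> 0 <= dot (row_mx lam lam0%:M) x.
Proof.
move=> lam_ge0 pos [_ [mu [_ mu0] <-] [_ [s s0 <-] <-]].
rewrite dotDr; apply: addr_ge0; last first.
  rewrite dot_row_mx dot0r addr0 /dot; apply: sumr_ge0 => j _.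
  by rewrite mulr_ge0.
have -> : dot (row_mx lam lam0%:M) (moments h mu) =
    integral_on mu (fun v => \sum_j lam 0 j * peval (h j) v + lam0 * 1).
  rewrite integral_onD//; last 2 first.
  - apply: continuous_sumr => j v; apply: continuousM; first exact: cst_continuous.
    exact: peval_continuous.
  - exact: cst_continuous.
  rewrite integral_on_sum//; last by move=> j; exact: peval_continuous.
  rewrite integral_onZ//; last exact: cst_continuous.
  rewrite /moments dot_row_mx; congr (_ + _).
    by apply: eq_bigr => j _; rewrite mxE.
  by rewrite /dot big_ord1 !mxE eqxx mulr1n.
by apply: integral_on_ge0 => // v Av; rewrite mulr1; exact: pos.
Qed.

(** Strong duality for the linear problem over measures.  The vectors of excess
    moments and excess objective of atomic measures form a convex set that misses
    the origin, since an atomic measure with feasible moments and objective below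
    c would contradict the bound c.  In a separating functional
    (tau, lam0, lam) the case tau = 0 is excluded by the interior point
    hypothesis: the functional would be nonnegative on the moment cone and
    nonpositive at an interior point.  Scaling to tau = 1 and testing with
    large point masses gives the inequality at every point of A. *)
Lemma moment_multipliers :
  (moment_cone A0 h)° (row_mx gamma (const_mx 1)) ->
  (forall mu, primal_feasible A0 h gamma mu -> c <= integral_on mu G) ->
  exists (lam : 'rV[R]_J) lam0, [/\ orthant J lam,
    forall v, A v -> 0 <= G v + \sum_j lam 0 j * peval (h j) v + lam0 &
    c <= dual_obj gamma lam lam0].
Proof.
move=> Hint Hc.
pose hs s : 'rV[R]_J := \row_j ai s (peval (h j)).
pose Y s sl : 'rV[R]_(1 + J) := row_mx (ai s (fun=> 1) - 1)%:M (hs s + sl - gamma).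
pose C := [set z : 'rV[R]_(1 + (1 + J)) | exists s sl, [/\ orthant J sl,
  rsubmx z = Y s sl & ai s G - c < lsubmx z 0 0]].
have Cc : convex C.
  move=> z z' a b [s [sl [sl0 zr zl]]] [s' [sl' [sl0' zr' zl']]] a0 b0 ab.
  exists (scaleA (NngNum a0) s ++ scaleA (NngNum b0) s'), (a *: sl + b *: sl').
  have abE (x x' y : R) : a * x + b * x' - y = a * (x - y) + b * (x' - y).
    by rewrite -[in LHS](mul1r y) -ab; ring.
  split.
  - by move=> j; rewrite !mxE addr_ge0 ?mulr_ge0.
  - rewrite linearD !linearZ/= zr zr' /Y !scale_row_mx add_row_mx; congr row_mx.
      by rewrite !scale_scalar_mx -raddfD ai_comb/= abE.
    by apply/rowP => j; rewrite !mxE ai_comb/=; have := abE 0 0 (gamma 0 j); lra.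
  - have -> : lsubmx (a *: z + b *: z') 0 0 = a * lsubmx z 0 0 + b * lsubmx z' 0 0.
      by rewrite !mxE.
    by rewrite ai_comb/= abE; exact: lt_comb.
have C0 : ~ C 0.
  move=> [s [sl [sl0 /esym + +]]]; rewrite !linear0 mxE /Y.
  rewrite -[X in _ = X]row_mx0 => /eq_row_mx[/matrixP/(_ 0 0) + /rowP hE].
  rewrite !mxE eqxx mulr1n => /subr0_eq s1 sG.
  have [mu [mureg mu0] muE] := atomic_measure Ac (@norm_hausdorff _ _) s.
  have : c <= integral_on mu G.
    apply: Hc; split=> // [j|].
      rewrite muE; last exact: peval_continuous.
      by have := hE j; have := sl0 j; rewrite !mxE /ai; lra.
    by rewrite muE//; exact: cst_continuous.
  by rewrite muE//; move: sG; rewrite /ai; lra.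
have [z z0 zC] := @separation R (1 + J) C Cc C0.
pose tau := lsubmx (z : 'rV_(1 + (1 + J))) 0 0.
pose lam0 := lsubmx (rsubmx (z : 'rV_(1 + (1 + J)))) 0 0.
pose lam := rsubmx (rsubmx (z : 'rV_(1 + (1 + J)))).
have sc1 (M1 : 'M[R]_1) : M1 = (M1 0 0)%:M by exact: mx11_scalar.
have zE : z = row_mx tau%:M (row_mx lam0%:M lam).
  by rewrite -!sc1 !hsubmxK.
have key s sl t : orthant J sl -> ai s G - c < t ->
    0 <= tau * t + (lam0 * (ai s (fun=> 1) - 1) + dot lam (hs s + sl - gamma)).
  move=> sl0 st; rewrite -!dot_scalar -dot_row_mx -(@dot_row_mx R 1 (1 + J)) -zE.
  apply: zC; exists s, sl; split=> //; first by rewrite row_mxKr.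
  by rewrite row_mxKl mxE eqxx.
have o0 : orthant J (0 : 'rV[R]_J) by move=> j; rewrite mxE.
have ai0 f : ai [::] f = 0 by rewrite /ai /atomic_integral big_nil.
have t0 : ai [::] G - c < 1 - c by rewrite ai0; lra.
have tau_ge0 : 0 <= tau.
  apply: (@ray_ge0 _ (tau * (1 - c) + (lam0 * (ai [::] (fun=> 1) - 1)
    + dot lam (hs [::] + 0 - gamma)))) => r r0.
  have := @key [::] 0 (1 - c + r) o0; rewrite ai0 => /(_ _); lra.
have lam_ge0 : orthant J lam.
  move=> j; apply: (@ray_ge0 _ (tau * (1 - c) + (lam0 * (ai [::] (fun=> 1) - 1)
    + dot lam (hs [::] - gamma)))) => r r0.
  have := @key [::] (r *: delta_mx 0 j) (1 - c) _ t0.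
  rewrite (addrAC (hs _)) (dotDr lam (hs _ - _)) dotZr dot_delta !addrA; apply=> i.
  by rewrite !mxE mulr_ge0.
pose ell v := tau * G v + (\sum_j lam 0 j * peval (h j) v + lam0).
pose B := tau * c + lam0 + dot lam gamma.
have keyB s : B <= tau * ai s G + lam0 * ai s (fun=> 1) + dot lam (hs s).
  apply/ler_addgt0Pr => e e0.
  have := @key s 0 (ai s G - c + e / (tau + 1)) o0.
  rewrite ltrDl divr_gt0 ?ltr_wpDl// => /(_ isT).
  rewrite addr0 dotDr dotNr mulrDr.
  have : tau * (e / (tau + 1)) <= e.
    rewrite mulrCA ger_pMr// ler_pdivrMr ?ltr_wpDl//; lra.
  rewrite /B; lra.
have B0 : B <= 0.
  have := keyB [::]; rewrite !ai0 (_ : hs [::] = 0) ?dot0r ?mulr0 ?addr0//.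
  by apply/rowP => j; rewrite !mxE ai0.
have ell_ge0 v : A v -> 0 <= ell v.
  move=> /dirac_ai[x xv]; apply: (@ray_ge0 _ (- B)) => r r0.
  have := keyB [:: (NngNum r0, x)].
  have ai1 f : ai [:: (NngNum r0, x)] f = r * f v.
    by rewrite /ai /atomic_integral big_seq1/= xv.
  rewrite !ai1 (_ : hs _ = r *: \row_j peval (h j) v); last first.
    by apply/rowP => j; rewrite !mxE ai1.
  rewrite dotZr (_ : dot _ _ = \sum_j lam 0 j * peval (h j) v); last first.
    by apply: eq_bigr => j _; rewrite mxE.
  by rewrite /ell; lra.
have tau_gt0 : 0 < tau.
  rewrite lt_def tau_ge0 andbT; apply/negP => /eqP tau0.
  have psi0 : row_mx lam lam0%:M != 0.
    apply: contra z0 => /eqP; rewrite -[X in _ = X]row_mx0 => /eq_row_mx[l0 m0].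
    by rewrite zE l0 m0 tau0 raddf0 !row_mx0.
  have := @interior_dot_gt0 _ _ _ _ _ psi0 Hint.
  have -> : const_mx 1 = 1%:M :> 'M[R]_1.
    by apply/matrixP => i j; rewrite !ord1 !mxE.
  rewrite dot_row_mx dot_scalar mulr1 => psi_gt0.
  suff : 0 < dot lam gamma + lam0 by move: B0; rewrite /B tau0; lra.
  apply: psi_gt0 => x; apply: moment_cone_ge0 => // v /ell_ge0.
  by rewrite /ell tau0 mul0r add0r.
exists (tau^-1 *: lam), (tau^-1 * lam0); split.
- by move=> j; rewrite mxE mulr_ge0// invr_ge0.
- move=> v /ell_ge0 elv; under eq_bigr => j _ do rewrite mxE -mulrA.
  rewrite -mulr_sumr -(pmulr_rge0 _ tau_gt0) !mulrDr !mulrA.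
  by rewrite divff ?gt_eqF// !mul1r; move: elv; rewrite /ell; lra.
- rewrite /dual_obj; under eq_bigr => j _ do rewrite mxE -mulrA.
  rewrite -mulr_sumr -(ler_pM2l tau_gt0) mulrBr mulrN !mulrA divff ?gt_eqF// !mul1r.
  by move: B0; rewrite /B /dot; lra.
Qed.

End MomentMultipliers.

(** * The dual problem *)

Section Duality.
Context {R : realType} {m N nu r L J : nat}.
Variables (F0 : 'M[R]_nu) (F : 'I_m -> 'M[R]_nu) (M : 'I_N -> 'M[R]_nu).
Variables (g : 'I_r.+1 -> 'I_L.+1 -> mpoly m R) (h : 'I_J -> mpoly m R).

Lemma le_maxI n (f : 'I_n.+1 -> R) i : f i <= maxI f.
Proof. exact: le_bigmax. Qed.

Lemma minI_le n (f : 'I_n.+1 -> R) i : minI f <= f i.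
Proof. exact: bigmin_le. Qed.

Lemma maxI_attained n (f : 'I_n.+1 -> R) : exists i, maxI f = f i.
Proof.
rewrite /maxI; elim/big_ind: _ => [|x y [i ->] [j ->]|i _]; first by exists ord0.
  by rewrite /Num.max; case: ifP => _; [exists j|exists i].
by exists i.
Qed.

Lemma minI_attained n (f : 'I_n.+1 -> R) : exists i, minI f = f i.
Proof.
rewrite /minI; elim/big_ind: _ => [|x y [i ->] [j ->]|i _]; first by exists ord0.
  by rewrite /Num.min; case: ifP => _; [exists i|exists j].
by exists i.
Qed.

Lemma simplex_le_maxI (delta : 'rV[R]_L.+1) (f : 'I_L.+1 -> R) :
  simplex L.+1 delta -> \sum_l delta 0 l * f l <= maxI f.
Proof.
move=> [d0 d1]; rewrite -[leRHS]mul1r -d1 mulr_suml; apply: ler_sum => l _.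
by rewrite ler_wpM2l// le_maxI.
Qed.

Lemma peval_dual_poly lam lam0 Z delta k v :
  peval (dual_poly F0 F g h lam lam0 Z delta k) v =
  \sum_l delta 0 l * peval (g k l) v + \sum_j lam 0 j * peval (h j) v + lam0
    - (\tr (Z *m F0) + \sum_i v 0 i * \tr (Z *m F i)).
Proof.
rewrite /dual_poly !pevalB !pevalD !pevalC !peval_sum opprD addrA.
congr (_ + _ + _ - _ - _); apply: eq_bigr => i _; rewrite pevalZ// pevalX mulrC//.
Qed.

(** Weak duality, by integrating the pointwise inequality against mu. *)
Lemma dual_objective_le A (A0 : A !=set0) (gamma : 'rV[R]_J) mu lam lam0 :
  compact A -> primal_feasible A0 h gamma mu -> orthant J lam ->
  (forall v, A v -> 0 <= minI (fun k => maxI (fun l => peval (g k l) v)) +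
    \sum_j lam 0 j * peval (h j) v + lam0) ->
  dual_obj gamma lam lam0 <= primal_obj A0 g mu.
Proof.
move=> Ac [[_ mu0] muh mu1] lam_ge0 pos.
have Gc : continuous
    (fun v : 'rV[R]_m => minI (fun k => maxI (fun l => peval (g k l) v))).
  apply: continuous_minI => k; apply: continuous_maxI => l.
  exact: peval_continuous.
have hc : continuous (fun v : 'rV[R]_m => \sum_j lam 0 j * peval (h j) v).
  apply: continuous_sumr => j v; apply: continuousM; first exact: cst_continuous.
  exact: peval_continuous.
have Ghc : continuous (fun v : 'rV[R]_m =>
    minI (fun k => maxI (fun l => peval (g k l) v)) +
      \sum_j lam 0 j * peval (h j) v).
  by move=> v; apply: continuousD; [exact: Gc|exact: hc].
have cc (c : R) : continuous ((fun=> c) : 'rV[R]_m -> R) by exact: cst_continuous.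
have := @integral_on_ge0 R _ A A0 mu (fun v =>
  minI (fun k => maxI (fun l => peval (g k l) v)) +
    \sum_j lam 0 j * peval (h j) v + lam0 * 1) mu0.
rewrite integral_onD// integral_onD// integral_on_sum//; last first.
  by move=> j; exact: peval_continuous.
rewrite integral_onZ// mu1 -/(primal_obj A0 g mu) mulr1.
have : \sum_j lam 0 j * integral_on mu (peval (h j)) <= \sum_j lam 0 j * gamma 0 j.
  by apply: ler_sum => j _; rewrite ler_wpM2l.
rewrite /dual_obj => hle /(_ pos); lra.
Qed.

Lemma psd_lmi_ge0 (Z : 'M[R]_nu) v : psd Z -> (forall t, \tr (Z *m M t) = 0) ->
  Omega F0 F M v -> 0 <= \tr (Z *m F0) + \sum_i v 0 i * \tr (Z *m F i).
Proof.
move=> Zp ZM [xi /(psd_trace_ge0 Zp)].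
by rewrite trace_lmi [X in _ + X]big1 ?addr0// => t _; rewrite ZM mulr0.
Qed.

Lemma dual_feasible_lower_bound d lam lam0 Z delta v :
  dual_feasible F0 F M g h d lam lam0 Z delta -> Omega F0 F M v ->
  0 <= minI (fun k => maxI (fun l => peval (g k l) v)) +
    \sum_j lam 0 j * peval (h j) v + lam0.
Proof.
move=> [_ feas] vO.
have [k ->] := minI_attained (fun k => maxI (fun l => peval (g k l) v)).
have [Zp dk [/(@sos_ge0 _ _ _ v) + _] ZM] := feas k.
rewrite peval_dual_poly; have := psd_lmi_ge0 Zp ZM vO.
have := simplex_le_maxI (fun l => peval (g k l) v) dk.
lra.
Qed.

Lemma sos_convex_dual_poly lam lam0 Z delta k :
  (forall l, sos_convex (g k l)) -> (forall j, sos_convex (h j)) ->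
  simplex L.+1 delta -> orthant J lam ->
  sos_convex (dual_poly F0 F g h lam lam0 Z delta k).
Proof.
move=> gc hc [d0 _] lam_ge0.
have constC c : sos_convex (mpolyC m c : mpoly m R).
  by apply: sos_convex_affine => i j; rewrite mderivC mderiv0.
have linC (t : R) i : sos_convex (t *: mpolyX R (mnm1 i) : mpoly m R).
  by apply: sos_convex_affine => j1 j2; rewrite !mderivZ mderivXU mderivC scaler0.
rewrite /dual_poly -sumrN -(rmorphN (@mpolyC m R)).
apply: sos_convexD; last first.
  by apply: sos_convex_sum => i; rewrite -scaleNr.
apply: sos_convexD; last exact: constC.
apply: sos_convexD; last exact: constC.
apply: sos_convexD.
  by apply: sos_convex_sum => l; exact: sos_convexZ.
by apply: sos_convex_sum => j; exact: sos_convexZ.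
Qed.

Lemma pdeg_leP (p : mpoly m R) d : (pdeg p <= d)%N = (mmeasure mdeg p <= d.+1)%N.
Proof. by rewrite /pdeg; case: (mmeasure mdeg p). Qed.

Lemma pdegD d (p q : mpoly m R) :
  (pdeg p <= d)%N -> (pdeg q <= d)%N -> (pdeg (p + q)%R <= d)%N.
Proof.
rewrite !pdeg_leP => pd qd.
by apply: leq_trans (msizeD_le _ _) _; rewrite geq_max pd.
Qed.

Lemma pdegZ d (p : mpoly m R) c : (pdeg p <= d)%N -> (pdeg (c *: p) <= d)%N.
Proof. by rewrite !pdeg_leP => pd; apply: leq_trans (msizeZ_le _ _) _. Qed.

Lemma pdegC d c : (pdeg (mpolyC m c : mpoly m R) <= d)%N.
Proof. by rewrite pdeg_leP msizeC; case: (c == 0). Qed.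

Lemma pdeg_sum d I (s : seq I) (f : I -> mpoly m R) :
  (forall i, (pdeg (f i) <= d)%N) -> (pdeg (\sum_(i <- s) f i)%R <= d)%N.
Proof.
move=> fd; elim/big_ind: _ => //; last exact: pdegD.
by rewrite -(rmorph0 (@mpolyC m R)) pdegC.
Qed.

(** Only d = 0 needs an argument: then D is constant, and a nonnegative affine
    function has no linear part. *)
Lemma pdeg_linear_part_nonneg (D : mpoly m R) (t : 'I_m -> R) d :
  (pdeg D <= d)%N -> (forall v, 0 <= peval D v - \sum_i v 0 i * t i) ->
  (pdeg (D - \sum_i t i *: mpolyX R (mnm1 i))%R <= d)%N.
Proof.
move=> Dd Dt; case: d Dd => [|d] Dd; last first.
  apply: pdegD => //; rewrite -sumrN; apply: pdeg_sum => i.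
  by rewrite -scaleNr; apply: pdegZ; rewrite pdeg_leP msizeX mdeg1.
suff t0 i : t i = 0.
  by rewrite big1 ?subr0// => i _; rewrite t0 scale0r.
have Dcst v : peval D v = peval D 0.
  by move: Dd; rewrite pdeg_leP => /msize1_polyC ->; rewrite !pevalC.
apply: oppr_inj; rewrite oppr0; apply: (@line_eq0 _ (peval D 0)) => s.
have := Dt (s *: delta_mx 0 i); rewrite Dcst (bigD1 i)//= big1 ?addr0.
  by rewrite !mxE !eqxx mulr1 mulrN.
by move=> j ji; rewrite !mxE (negPf ji) andbF mulr0 mul0r.
Qed.

Lemma dual_poly_Sigma2 d lam lam0 Z delta k :
  (forall l, sos_convex (g k l)) -> (forall j, sos_convex (h j)) ->
  (forall l, (pdeg (g k l) <= d)%N) -> (forall j, (pdeg (h j) <= d)%N) ->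
  simplex L.+1 delta -> orthant J lam ->
  (forall v, 0 <= peval (dual_poly F0 F g h lam lam0 Z delta k) v) ->
  Sigma2 d (dual_poly F0 F g h lam lam0 Z delta k).
Proof.
move=> gc hc gd hd dk lam_ge0 pos; split.
  by apply: sos_convex_nonneg_sos => //; exact: sos_convex_dual_poly.
apply: pdeg_linear_part_nonneg => [|v].
  apply: pdegD; last by rewrite -(rmorphN (@mpolyC m R)) pdegC.
  apply: pdegD; last exact: pdegC.
  by apply: pdegD; apply: pdeg_sum => i; exact: pdegZ.
have := pos v; rewrite /dual_poly pevalB; congr (0 <= _ - _).
by rewrite peval_sum; apply: eq_bigr => i _; rewrite pevalZ pevalX mulrC.
Qed.

End Duality.

Theorem theorem3p4 (R : realType) (m N nu r L J : nat)
  (F0 : 'M[R]_nu) (F : 'I_m -> 'M[R]_nu) (M : 'I_N -> 'M[R]_nu)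
  (g : 'I_r.+1 -> 'I_L.+1 -> mpoly m R) (h : 'I_J -> mpoly m R)
  (gamma : 'rV[R]_J) (d : nat)
  (F0_sym : F0 \is symmetricmx)
  (F_sym : forall i, F i \is symmetricmx)
  (M_sym : forall t, M t \is symmetricmx)
  (g_convex : forall k l, sos_convex (g k l))
  (h_convex : forall j, sos_convex (h j))
  (Omega_compact : compact (Omega F0 F M))
  (Hslater : slater F0 F M)
  (Hmoment :
     (moment_cone (Omega_nonempty Hslater) h)° (row_mx gamma (const_mx 1)))
  (Hmin : exists2 mu, primal_feasible (Omega_nonempty Hslater) h gamma mu &
     forall mu', primal_feasible (Omega_nonempty Hslater) h gamma mu' ->
       primal_obj (Omega_nonempty Hslater) g mu
         <= primal_obj (Omega_nonempty Hslater) g mu')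
  (Hd : least_even_degree_bound g h d) :
  exists c : R,
    is_minimum (primal_values (Omega_nonempty Hslater) g h gamma) c /\
    is_maximum (dual_values F0 F M g h gamma d) c.
Proof.
have [gdeg hdeg] : (forall k l, (pdeg (g k l) <= d)%N) /\
    (forall j, (pdeg (h j) <= d)%N).
  by have [[_ gd hd] _] := Hd.
have [mu mufeas mumin] := Hmin.
set A0 := Omega_nonempty Hslater in Hmoment mu mufeas mumin *.
set c := primal_obj A0 g mu.
have weak lam lam0 Z delta : dual_feasible F0 F M g h d lam lam0 Z delta ->
    dual_obj gamma lam lam0 <= c.
  move=> feas; apply: (dual_objective_le Omega_compact mufeas feas.1) => v.
  exact: dual_feasible_lower_bound feas.
exists c; split.
  split; first by exists mu.
  by move=> _ [mu' mu'feas <-]; exact: mumin.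
split; last by move=> _ [lam [lam0 [Z [delta [feas ->]]]]]; exact: weak feas.
have Gc : continuous
    (fun v : 'rV[R]_m => minI (fun k => maxI (fun l => peval (g k l) v))).
  apply: continuous_minI => k; apply: continuous_maxI => l.
  exact: peval_continuous.
have [lam [lam0 [lam_ge0 Gpos c_le]]] :=
  moment_multipliers Omega_compact Gc Hmoment mumin.
have cert k : exists Zd : 'M[R]_nu * 'rV[R]_L.+1,
    [/\ psd Zd.1, simplex L.+1 Zd.2,
      Sigma2 d (dual_poly F0 F g h lam lam0 Zd.1 Zd.2 k) &
      forall t, \tr (Zd.1 *m M t) = 0].
  pose phi l := g k l + (\sum_j lam 0 j *: h j + mpolyC m lam0).
  have phiE l v : peval (phi l) v =
      peval (g k l) v + (\sum_j lam 0 j * peval (h j) v + lam0).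
    rewrite !pevalD pevalC peval_sum; congr (_ + (_ + _)).
    by apply: eq_bigr => j _; rewrite pevalZ.
  have phic l : sos_convex (phi l).
    apply: sos_convexD => //; apply: sos_convexD.
      by apply: sos_convex_sum => j; exact: sos_convexZ.
    by apply: sos_convex_affine => i j; rewrite mderivC mderiv0.
  have [|delta [Z [dk Zp ZM pos]]] :=
    conic_multipliers F0_sym F_sym M_sym phic Hslater.
    move=> v /Gpos; have [l gl] := maxI_attained (fun l => peval (g k l) v).
    have := minI_le (fun k => maxI (fun l => peval (g k l) v)) k.
    by exists l; rewrite phiE -gl; lra.
  exists (Z, delta); split=> //=; apply: dual_poly_Sigma2 => // v.
  have := pos v; rewrite peval_dual_poly.
  under eq_bigr => l _ do rewrite phiE mulrDr.
  by rewrite big_split/= -mulr_suml dk.2 mul1r addrA.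
exists lam, lam0, (fun k => (projT1 (cid (cert k))).1),
  (fun k => (projT1 (cid (cert k))).2).
have feas : dual_feasible F0 F M g h d lam lam0
    (fun k => (projT1 (cid (cert k))).1) (fun k => (projT1 (cid (cert k))).2).
  by split=> // k; case: cid => -[Z delta].
split=> //; apply/eqP; rewrite eq_le c_le.
exact: weak feas.
Qed.
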